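(* Let $k$ be a perfect field and $L/k$ a finite Galois extension with Galois group $G$. The ring homomorphism $h_{L/k}:A(G)\to GW(k)$ is an isomorphism if and only if either $k$ is quadratically closed and $L=k$, or $k$ is euclidean and $L=k[i]$.
   Context: $A(G)$ is the Burnside ring of finite $G$-sets and $GW(k)$ is the Grothendieck–Witt ring of nondegenerate quadratic forms (symmetric bilinear forms) over $k$; $\langle a\rangle$ denotes the rank one form of $a\in k^\times$. The map $h_{L/k}:A(G)\to GW(k)$ is the unique ring homomorphism sending the class of the orbit $G/H$ to the trace form $\mathrm{tr}_{L^H/k}(\langle 1\rangle)$, i.e. the form $(x,y)\mapsto \mathrm{tr}_{L^H/k}(xy)$ on the $k$-vector space $L^H$, for every subgroup $H\subseteq G$. A field $k$ is quadratically closed if every element of $k$ is a square; it is euclidean if $-1$ is not a sum of squares in $k$ and $[k^\times:(k^\times)^2]=2$; $i$ is a square root of $-1$. *)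

(* Defs.v *)
From HB Require Import structures.
From mathcomp Require Import all_boot all_order all_algebra.
From mathcomp Require Import all_fingroup all_solvable all_field.
From mathcomp Require Import mxtens boolp ring.

Set Implicit Arguments.
Unset Strict Implicit.
Unset Printing Implicit Defensive.

Import GRing.Theory.
Local Open Scope quotient_scope.
Local Open Scope ring_scope.

(* A commutative semiring up to isomorphism: a class of objects with two      *)
(* operations satisfying the semiring laws up to the equivalence riso.        *)
Record rig_upto := RigUpto {
  robj :> Type;
  riso : robj -> robj -> Prop;
  radd : robj -> robj -> robj;
  rmul : robj -> robj -> robj;
  rzero : robj;
  rone : robj;
  riso_refl : forall X, riso X X;
  riso_sym : forall X Y, riso X Y -> riso Y X;
  riso_trans : forall X Y Z, riso X Y -> riso Y Z -> riso X Z;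
  radd_iso : forall X X' Y Y',
    riso X X' -> riso Y Y' -> riso (radd X Y) (radd X' Y');
  rmul_iso : forall X X' Y Y',
    riso X X' -> riso Y Y' -> riso (rmul X Y) (rmul X' Y');
  raddA : forall X Y Z, riso (radd X (radd Y Z)) (radd (radd X Y) Z);
  raddC : forall X Y, riso (radd X Y) (radd Y X);
  radd0 : forall X, riso (radd rzero X) X;
  rmulA : forall X Y Z, riso (rmul X (rmul Y Z)) (rmul (rmul X Y) Z);
  rmulC : forall X Y, riso (rmul X Y) (rmul Y X);
  rmul1 : forall X, riso (rmul rone X) X;
  rmulD : forall X Y Z,
    riso (rmul (radd X Y) Z) (radd (rmul X Z) (rmul Y Z));
  rmul0 : forall X, riso (rmul rzero X) rzero }.

Section IsoClasses.
Variable S : rig_upto.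

Definition riso_rel : rel {classic S} := fun X Y => `[< @riso S X Y >].

Lemma riso_relP : equiv_class_of riso_rel.
Proof.
split=> [X|X Y|Y X Z]; first by apply/asboolP/riso_refl.
  by apply/asboolP/asboolP; apply: riso_sym.
by move=> /asboolP XY /asboolP YZ; apply/asboolP; apply: riso_trans XY YZ.
Qed.

Canonical riso_equiv := EquivRelPack riso_relP.

Definition iso_class := {eq_quot riso_equiv}.
HB.instance Definition _ := Choice.on iso_class.
HB.instance Definition _ := EqQuotient.on iso_class.

Definition to_iso_class (X : S) : iso_class := \pi_iso_class (X : {classic S}).
Local Notation cl := to_iso_class.

Lemma iso_classP (X Y : S) : cl X = cl Y <-> riso X Y.
Proof. by split=> [/eqmodP/asboolP|XY] //; apply/eqmodP/asboolP. Qed.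

Lemma iso_class_ind (P : iso_class -> Prop) :
  (forall X : S, P (cl X)) -> forall x, P x.
Proof. by move=> PX x; rewrite -[x]reprK; apply: PX. Qed.

Lemma repr_to_iso_class (X : S) : riso (generic_quotient.repr (cl X)) X.
Proof. by apply/iso_classP; rewrite /cl reprK. Qed.

Definition iso_class_add (x y : iso_class) : iso_class :=
  cl (@radd S (generic_quotient.repr x) (generic_quotient.repr y)).
Definition iso_class_mul (x y : iso_class) : iso_class :=
  cl (@rmul S (generic_quotient.repr x) (generic_quotient.repr y)).

Lemma iso_class_addE X Y : iso_class_add (cl X) (cl Y) = cl (radd X Y).
Proof. by apply/iso_classP/radd_iso; apply: repr_to_iso_class. Qed.
Lemma iso_class_mulE X Y : iso_class_mul (cl X) (cl Y) = cl (rmul X Y).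
Proof. by apply/iso_classP/rmul_iso; apply: repr_to_iso_class. Qed.

Lemma iso_class_addA : associative iso_class_add.
Proof.
elim/iso_class_ind=> X; elim/iso_class_ind=> Y; elim/iso_class_ind=> Z.
by rewrite !iso_class_addE; apply/iso_classP/raddA.
Qed.
Lemma iso_class_addC : commutative iso_class_add.
Proof.
elim/iso_class_ind=> X; elim/iso_class_ind=> Y.
by rewrite !iso_class_addE; apply/iso_classP/raddC.
Qed.
Lemma iso_class_add0 : left_id (cl (rzero S)) iso_class_add.
Proof.
by elim/iso_class_ind=> X; rewrite iso_class_addE; apply/iso_classP/radd0.
Qed.

HB.instance Definition _ := GRing.isNmodule.Build iso_class
  iso_class_addA iso_class_addC iso_class_add0.

Lemma iso_class_mulA : associative iso_class_mul.
Proof.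
elim/iso_class_ind=> X; elim/iso_class_ind=> Y; elim/iso_class_ind=> Z.
by rewrite !iso_class_mulE; apply/iso_classP/rmulA.
Qed.
Lemma iso_class_mulC : commutative iso_class_mul.
Proof.
elim/iso_class_ind=> X; elim/iso_class_ind=> Y.
by rewrite !iso_class_mulE; apply/iso_classP/rmulC.
Qed.
Lemma iso_class_mul1 : left_id (cl (rone S)) iso_class_mul.
Proof.
by elim/iso_class_ind=> X; rewrite iso_class_mulE; apply/iso_classP/rmul1.
Qed.
Lemma iso_class_mulD : left_distributive iso_class_mul (@GRing.add iso_class).
Proof.
elim/iso_class_ind=> X; elim/iso_class_ind=> Y; elim/iso_class_ind=> Z.
rewrite [cl X + cl Y]iso_class_addE !iso_class_mulE [RHS]iso_class_addE.
by apply/iso_classP/rmulD.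
Qed.
Lemma iso_class_mul0 : left_zero (0 : iso_class) iso_class_mul.
Proof.
by elim/iso_class_ind=> X; rewrite iso_class_mulE; apply/iso_classP/rmul0.
Qed.

HB.instance Definition _ := GRing.Nmodule_isComPzSemiRing.Build iso_class
  iso_class_mulA iso_class_mulC iso_class_mul1 iso_class_mulD iso_class_mul0.

Lemma to_iso_classD X Y : cl (radd X Y) = cl X + cl Y.
Proof. by rewrite -iso_class_addE. Qed.
Lemma to_iso_classM X Y : cl (rmul X Y) = cl X * cl Y.
Proof. by rewrite -iso_class_mulE. Qed.

End IsoClasses.

(* The Grothendieck ring of a commutative semiring: formal differences.       *)
Section Grothendieck.
Variable M : comPzSemiRingType.

Definition groth_rel : rel (M * M) := fun x y =>
  `[< exists e, x.1 + y.2 + e = y.1 + x.2 + e >].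

Lemma groth_relP : equiv_class_of groth_rel.
Proof.
split=> [x|x y|y x z]; first by apply/asboolP; exists 0.
  by apply/asboolP/asboolP=> -[e E]; exists e.
move=> /asboolP[e xy] /asboolP[f yz]; apply/asboolP.
exists (y.1 + y.2 + (e + f)).
transitivity ((x.1 + y.2 + e) + (y.1 + z.2 + f)); first by ring.
by rewrite xy yz; ring.
Qed.

Canonical groth_equiv := EquivRelPack groth_relP.

Definition groth := {eq_quot groth_equiv}.
HB.instance Definition _ := Choice.on groth.
HB.instance Definition _ := EqQuotient.on groth.

Definition gdiff (a b : M) : groth := \pi_groth (a, b).
Definition to_groth (a : M) : groth := gdiff a 0.

Lemma gdiffP a b c d :
  gdiff a b = gdiff c d <-> exists e, a + d + e = c + b + e.
Proof. by split=> [/eqmodP/asboolP|E] //; apply/eqmodP/asboolP. Qed.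

Lemma groth_ind (P : groth -> Prop) :
  (forall a b, P (gdiff a b)) -> forall x, P x.
Proof. by move=> Pd x; rewrite -[x]reprK; case: (generic_quotient.repr x). Qed.

Lemma repr_gdiff a b : exists e,
  (generic_quotient.repr (gdiff a b)).1 + b + e =
  a + (generic_quotient.repr (gdiff a b)).2 + e.
Proof.
have : \pi_groth (generic_quotient.repr (gdiff a b)) = gdiff a b.
  by rewrite reprK.
by case: (generic_quotient.repr _) => c d /gdiffP.
Qed.

Definition groth_add (x y : groth) : groth :=
  let: (a, b) := generic_quotient.repr x in
  let: (c, d) := generic_quotient.repr y in gdiff (a + c) (b + d).
Definition groth_opp (x : groth) : groth :=
  let: (a, b) := generic_quotient.repr x in gdiff b a.
Definition groth_mul (x y : groth) : groth :=
  let: (a, b) := generic_quotient.repr x in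
  let: (c, d) := generic_quotient.repr y in
  gdiff (a * c + b * d) (a * d + b * c).

Lemma groth_addE a b c d :
  groth_add (gdiff a b) (gdiff c d) = gdiff (a + c) (b + d).
Proof.
rewrite /groth_add; have := repr_gdiff c d; have := repr_gdiff a b.
case: (generic_quotient.repr _) => a' b' /= [e E].
case: (generic_quotient.repr _) => c' d' /= [f F].
apply/gdiffP; exists (e + f).
transitivity ((a' + b + e) + (c' + d + f)); first by ring.
by rewrite E F; ring.
Qed.

Lemma groth_oppE a b : groth_opp (gdiff a b) = gdiff b a.
Proof.
rewrite /groth_opp; have := repr_gdiff a b.
case: (generic_quotient.repr _) => a' b' /= [e E].
apply/gdiffP; exists e.
transitivity (a + b' + e); first by ring.
by rewrite -E; ring.
Qed.

Lemma groth_mulE a b c d :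
  groth_mul (gdiff a b) (gdiff c d) = gdiff (a * c + b * d) (a * d + b * c).
Proof.
rewrite /groth_mul; have := repr_gdiff c d; have := repr_gdiff a b.
case: (generic_quotient.repr _) => a' b' /= [e E].
case: (generic_quotient.repr _) => c' d' /= [f F].
transitivity (gdiff (a * c' + b * d') (a * d' + b * c')); apply/gdiffP.
  exists (e * c' + e * d').
  transitivity ((a' + b + e) * c' + (a + b' + e) * d'); first by ring.
  transitivity ((a + b' + e) * c' + (a' + b + e) * d'); last by ring.
  by rewrite E.
exists (f * a + f * b).
transitivity ((c' + d + f) * a + (c + d' + f) * b); first by ring.
transitivity ((c + d' + f) * a + (c' + d + f) * b); last by ring.
by rewrite F.
Qed.

Lemma groth_addA : associative groth_add.
Proof.
elim/groth_ind=> a b; elim/groth_ind=> c d; elim/groth_ind=> e f.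
by rewrite !groth_addE !addrA.
Qed.
Lemma groth_addC : commutative groth_add.
Proof.
elim/groth_ind=> a b; elim/groth_ind=> c d.
by rewrite !groth_addE addrC [b + d]addrC.
Qed.
Lemma groth_add0 : left_id (to_groth 0) groth_add.
Proof. by elim/groth_ind=> a b; rewrite groth_addE !add0r. Qed.
Lemma groth_addN : left_inverse (to_groth 0) groth_opp groth_add.
Proof.
elim/groth_ind=> a b; rewrite groth_oppE groth_addE; apply/gdiffP.
by exists 0; ring.
Qed.

HB.instance Definition _ := GRing.isZmodule.Build groth
  groth_addA groth_addC groth_add0 groth_addN.

Lemma groth_mulA : associative groth_mul.
Proof.
elim/groth_ind=> a b; elim/groth_ind=> c d; elim/groth_ind=> e f.
by rewrite !groth_mulE; congr gdiff; ring.
Qed.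
Lemma groth_mulC : commutative groth_mul.
Proof.
elim/groth_ind=> a b; elim/groth_ind=> c d.
by rewrite !groth_mulE; congr gdiff; ring.
Qed.
Lemma groth_mul1 : left_id (to_groth 1) groth_mul.
Proof. by elim/groth_ind=> a b; rewrite groth_mulE; congr gdiff; ring. Qed.
Lemma groth_mulD : left_distributive groth_mul (@GRing.add groth).
Proof.
elim/groth_ind=> a b; elim/groth_ind=> c d; elim/groth_ind=> e f.
rewrite [gdiff a b + gdiff c d]groth_addE !groth_mulE [RHS]groth_addE.
by congr gdiff; ring.
Qed.

HB.instance Definition _ := GRing.Zmodule_isComPzRing.Build groth
  groth_mulA groth_mulC groth_mul1 groth_mulD.

End Grothendieck.

(* Every finite G-set is isomorphic to one carried by some 'I_n; fixing such  *)
(* carriers makes the finite G-sets a type small enough to be quotiented.     *)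
(* The actions of a group in mathcomp are right actions.                      *)
Record gset (gT : finGroupType) := GSet {
  gset_card : nat;
  gset_act :> {action gT &-> 'I_gset_card} }.

Section GSets.
Variable gT : finGroupType.
Implicit Types (T U V : finType).

Definition act_iso T U (to : {action gT &-> T}) (to' : {action gT &-> U}) :=
  exists2 f : T -> U, bijective f & forall x a, f (to x a) = to' (f x) a.

Lemma act_iso_refl T (to : {action gT &-> T}) : act_iso to to.
Proof. by exists id => //; exists id. Qed.

Lemma act_iso_sym T U (to : {action gT &-> T}) (to' : {action gT &-> U}) :
  act_iso to to' -> act_iso to' to.
Proof.
case=> f [g fK gK] fE; exists g; first by exists f.
by move=> y a; apply: (can_inj fK); rewrite fE !gK.
Qed.

Lemma act_iso_trans T U V (to : {action gT &-> T}) (to' : {action gT &-> U})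
    (to'' : {action gT &-> V}) :
  act_iso to to' -> act_iso to' to'' -> act_iso to to''.
Proof.
case=> f fb fE [g gb gE]; exists (g \o f); first exact: bij_comp.
by move=> x a /=; rewrite fE gE.
Qed.

Definition enum_act_fun T (to : {action gT &-> T}) (i : 'I_#|T|) (a : gT) :=
  enum_rank (to (enum_val i) a).

Lemma enum_act_fun1 T (to : {action gT &-> T}) :
  enum_act_fun to ^~ 1%g =1 id.
Proof. by move=> i; rewrite /enum_act_fun act1 enum_valK. Qed.
Lemma enum_act_funM T (to : {action gT &-> T}) :
  forall x, act_morph (enum_act_fun to) x.
Proof. by move=> i a b; rewrite /enum_act_fun enum_rankK actM. Qed.

Definition gset_of T (to : {action gT &-> T}) : gset gT :=
  GSet (TotalAction (enum_act_fun1 to) (enum_act_funM to)).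

Lemma gset_ofP T (to : {action gT &-> T}) : act_iso (gset_of to) to.
Proof.
exists enum_val; first by exists enum_rank; [apply: enum_valK|apply: enum_rankK].
by move=> i a; rewrite /= /enum_act_fun enum_rankK.
Qed.

Definition empty_act_fun (x : void) (a : gT) := x.
Lemma empty_act_fun1 : empty_act_fun ^~ 1%g =1 id. Proof. by []. Qed.
Lemma empty_act_funM : forall x, act_morph empty_act_fun x. Proof. by []. Qed.
Definition empty_act : {action gT &-> void} :=
  TotalAction empty_act_fun1 empty_act_funM.

Definition triv_act_fun (x : unit) (a : gT) := x.
Lemma triv_act_fun1 : triv_act_fun ^~ 1%g =1 id. Proof. by []. Qed.
Lemma triv_act_funM : forall x, act_morph triv_act_fun x. Proof. by []. Qed.
Definition triv_act : {action gT &-> unit} :=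
  TotalAction triv_act_fun1 triv_act_funM.

Section SumProd.
Variables (T U : finType) (to : {action gT &-> T}) (to' : {action gT &-> U}).

Definition sum_act_fun (x : T + U) (a : gT) : T + U :=
  match x with inl t => inl (to t a) | inr u => inr (to' u a) end.
Lemma sum_act_fun1 : sum_act_fun ^~ 1%g =1 id.
Proof. by case=> x /=; rewrite act1. Qed.
Lemma sum_act_funM : forall x, act_morph sum_act_fun x.
Proof. by case=> x a b /=; rewrite actM. Qed.
Definition sum_act : {action gT &-> T + U} :=
  TotalAction sum_act_fun1 sum_act_funM.

Definition prod_act_fun (x : T * U) (a : gT) : T * U :=
  (to x.1 a, to' x.2 a).
Lemma prod_act_fun1 : prod_act_fun ^~ 1%g =1 id.
Proof. by case=> x y; rewrite /prod_act_fun /= !act1. Qed.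
Lemma prod_act_funM : forall x, act_morph prod_act_fun x.
Proof. by case=> x y a b; rewrite /prod_act_fun /= !actM. Qed.
Definition prod_act : {action gT &-> T * U} :=
  TotalAction prod_act_fun1 prod_act_funM.

End SumProd.

Lemma sum_act_iso T T' U U' (a : {action gT &-> T}) (a' : {action gT &-> T'})
    (b : {action gT &-> U}) (b' : {action gT &-> U'}) :
  act_iso a a' -> act_iso b b' -> act_iso (sum_act a b) (sum_act a' b').
Proof.
case=> f [f' fK f'K] fE [g [g' gK g'K] gE].
exists (fun x => match x with inl t => inl (f t) | inr u => inr (g u) end).
  exists (fun x => match x with inl t => inl (f' t) | inr u => inr (g' u) end).
    by case=> x; rewrite ?fK ?gK.
  by case=> x; rewrite ?f'K ?g'K.
by case=> x c /=; rewrite ?fE ?gE.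
Qed.

Lemma prod_act_iso T T' U U' (a : {action gT &-> T}) (a' : {action gT &-> T'})
    (b : {action gT &-> U}) (b' : {action gT &-> U'}) :
  act_iso a a' -> act_iso b b' -> act_iso (prod_act a b) (prod_act a' b').
Proof.
case=> f [f' fK f'K] fE [g [g' gK g'K] gE].
exists (fun x => (f x.1, g x.2)).
  exists (fun x => (f' x.1, g' x.2)) => -[x y] /=.
    by rewrite fK gK.
  by rewrite f'K g'K.
by case=> x y c /=; rewrite /prod_act_fun /= fE gE.
Qed.

Definition gset_add (X Y : gset gT) := gset_of (sum_act X Y).
Definition gset_mul (X Y : gset gT) := gset_of (prod_act X Y).
Definition gset_iso (X Y : gset gT) := act_iso X Y.

Local Notation "X ~ Y" := (act_iso X Y) (at level 70).

Lemma gset_of_iso T U (a : {action gT &-> T}) (b : {action gT &-> U}) :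
  a ~ b -> gset_of a ~ gset_of b.
Proof.
move=> ab; apply: act_iso_trans (gset_ofP a) _; apply: act_iso_trans ab _.
exact/act_iso_sym/gset_ofP.
Qed.

Lemma gset_add_iso (X X' Y Y' : gset gT) :
  gset_iso X X' -> gset_iso Y Y' -> gset_iso (gset_add X Y) (gset_add X' Y').
Proof. by move=> ? ?; apply/gset_of_iso/sum_act_iso. Qed.

Lemma gset_mul_iso (X X' Y Y' : gset gT) :
  gset_iso X X' -> gset_iso Y Y' -> gset_iso (gset_mul X Y) (gset_mul X' Y').
Proof. by move=> ? ?; apply/gset_of_iso/prod_act_iso. Qed.

Let oP := gset_ofP.
Let rf := act_iso_refl.

Lemma gset_addA (X Y Z : gset gT) :
  gset_iso (gset_add X (gset_add Y Z)) (gset_add (gset_add X Y) Z).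
Proof.
apply: gset_of_iso; apply: act_iso_trans (sum_act_iso (rf X) (oP _)) _.
apply: act_iso_trans _ (act_iso_sym (sum_act_iso (oP _) (rf Z))).
exists (fun x => match x with inl x => inl (inl x)
  | inr (inl y) => inl (inr y) | inr (inr z) => inr z end); last by case=> [|[]].
by exists (fun x => match x with inl (inl x) => inl x
  | inl (inr y) => inr (inl y) | inr z => inr (inr z) end); case=> [|[]] // [].
Qed.

Lemma gset_addC (X Y : gset gT) : gset_iso (gset_add X Y) (gset_add Y X).
Proof.
apply: gset_of_iso.
exists (fun x => match x with inl x => inr x | inr y => inl y end).
  by exists (fun x => match x with inl x => inr x | inr y => inl y end); case.
by case.
Qed.

Lemma gset_add0 (X : gset gT) : gset_iso (gset_add (gset_of empty_act) X) X.
Proof.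
apply: act_iso_trans (oP _) _.
apply: act_iso_trans (sum_act_iso (oP _) (rf X)) _.
exists (fun x : void + _ => match x with inl x => of_void _ x | inr y => y end).
  by exists inr => [[[]|]|].
by case=> [[]|].
Qed.

Lemma gset_mulA (X Y Z : gset gT) :
  gset_iso (gset_mul X (gset_mul Y Z)) (gset_mul (gset_mul X Y) Z).
Proof.
apply: gset_of_iso; apply: act_iso_trans (prod_act_iso (rf X) (oP _)) _.
apply: act_iso_trans _ (act_iso_sym (prod_act_iso (oP _) (rf Z))).
exists (fun x => ((x.1, x.2.1), x.2.2)); last by [].
by exists (fun x => (x.1.1, (x.1.2, x.2))); [case=> ? []|case=> -[]].
Qed.

Lemma gset_mulC (X Y : gset gT) : gset_iso (gset_mul X Y) (gset_mul Y X).
Proof.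
apply: gset_of_iso; exists (fun x => (x.2, x.1)); last by [].
by exists (fun x => (x.2, x.1)); case.
Qed.

Lemma gset_mul1 (X : gset gT) : gset_iso (gset_mul (gset_of triv_act) X) X.
Proof.
apply: act_iso_trans (oP _) _.
apply: act_iso_trans (prod_act_iso (oP _) (rf X)) _.
by exists (fun x => x.2) => //; exists (pair tt) => [[[]]|].
Qed.

Lemma gset_mulD (X Y Z : gset gT) :
  gset_iso (gset_mul (gset_add X Y) Z)
           (gset_add (gset_mul X Z) (gset_mul Y Z)).
Proof.
apply: gset_of_iso; apply: act_iso_trans (prod_act_iso (oP _) (rf Z)) _.
apply: act_iso_trans _ (act_iso_sym (sum_act_iso (oP _) (oP _))).
exists (fun x => match x.1 with inl y => inl (y, x.2) | inr y => inr (y, x.2) end).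
  by exists (fun x => match x with inl y => (inl y.1, y.2)
    | inr y => (inr y.1, y.2) end); [case=> -[]|case=> -[]].
by case=> -[].
Qed.

Lemma gset_mul0 (X : gset gT) :
  gset_iso (gset_mul (gset_of empty_act) X) (gset_of empty_act).
Proof.
apply: gset_of_iso; apply: act_iso_trans (prod_act_iso (oP _) (rf X)) _.
by exists (fun x => x.1); [exists (of_void _); case=> -[]|case=> -[]].
Qed.

Definition gset_rig : rig_upto := {|
  riso := gset_iso; radd := gset_add; rmul := gset_mul;
  rzero := gset_of empty_act; rone := gset_of triv_act;
  riso_refl := fun X => act_iso_refl X;
  riso_sym := fun X Y => @act_iso_sym _ _ X Y;
  riso_trans := fun X Y Z => @act_iso_trans _ _ _ X Y Z;
  radd_iso := gset_add_iso; rmul_iso := gset_mul_iso;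
  raddA := gset_addA; raddC := gset_addC; radd0 := gset_add0;
  rmulA := gset_mulA; rmulC := gset_mulC; rmul1 := gset_mul1;
  rmulD := gset_mulD; rmul0 := gset_mul0 |}.

Definition burnside := groth (iso_class gset_rig).
HB.instance Definition _ := GRing.ComPzRing.on burnside.

Definition burnside_class T (to : {action gT &-> T}) : burnside :=
  to_groth (to_iso_class (gset_of to : gset_rig)).

(* G/H: right translation on the right cosets of H.                           *)
Section Orbit.
Variable H : {group gT}.

Definition coset_space := {C : {set gT} | C \in rcosets H [set: gT]}.

Lemma coset_trans_subproof (C : coset_space) a :
  (val C :* a)%g \in rcosets H [set: gT].
Proof.
case: C => C /= /rcosetsP[x _ ->]; rewrite -rcosetM mem_rcosets.
by rewrite mulSGid ?subsetT ?inE.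
Qed.

Definition coset_trans (C : coset_space) a : coset_space :=
  Sub (val C :* a)%g (coset_trans_subproof C a).
Lemma coset_trans1 : coset_trans ^~ 1%g =1 id.
Proof. by move=> C; apply: val_inj; rewrite /= rcoset1. Qed.
Lemma coset_transM : forall x, act_morph coset_trans x.
Proof. by move=> C a b; apply: val_inj; rewrite /= rcosetM. Qed.
Definition orbit_act : {action gT &-> coset_space} :=
  TotalAction coset_trans1 coset_transM.

End Orbit.
End GSets.

(* A nondegenerate symmetric bilinear form on k^n, given by its Gram matrix.  *)
Record sbform (k : fieldType) := SBForm {
  sbf_dim : nat;
  sbf_mx :> 'M[k]_sbf_dim;
  sbf_sym : sbf_mx^T = sbf_mx;
  sbf_unit : sbf_mx \in unitmx }.

Section Forms.
Variable k : fieldType.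

(* An isometry is a linear bijection u |-> u *m P of row vectors such that    *)
(* the form B pulls back to A.                                                *)
Definition isometric m n (A : 'M[k]_m) (B : 'M[k]_n) :=
  exists P : 'M[k]_(m, n), [/\ row_free P, row_full P & P *m B *m P^T = A].

Lemma isometric_refl n (A : 'M[k]_n) : isometric A A.
Proof.
exists 1%:M; rewrite row_free_unit row_full_unit unitmx1.
by split=> //; rewrite mul1mx trmx1 mulmx1.
Qed.

Lemma isometricE m n (A : 'M[k]_m) (B : 'M[k]_n) (P : 'M_(m, n)) Q :
  P *m Q = 1%:M -> Q *m P = 1%:M -> P *m B *m P^T = A -> isometric A B.
Proof.
move=> PQ QP E; exists P; split=> //; first by apply/row_freeP; exists Q.
by apply/row_fullP; exists Q.
Qed.

Lemma isometricP m n (A : 'M[k]_m) (B : 'M[k]_n) : isometric A B ->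
  exists P : 'M_(m, n), exists Q : 'M_(n, m),
    [/\ P *m Q = 1%:M, Q *m P = 1%:M & P *m B *m P^T = A].
Proof.
case=> P [/row_freeP[Q PQ] /row_fullP[Q' QP] E]; exists P, Q; split=> //.
suff <-: Q' = Q by [].
by rewrite -[Q']mulmx1 -PQ mulmxA QP mul1mx.
Qed.

Lemma isometric_sym m n (A : 'M[k]_m) (B : 'M[k]_n) :
  isometric A B -> isometric B A.
Proof.
case/isometricP=> P [Q [PQ QP <-]]; apply: (isometricE QP PQ).
by rewrite !mulmxA QP mul1mx -mulmxA -trmx_mul QP trmx1 mulmx1.
Qed.

Lemma isometric_trans m n p (A : 'M[k]_m) (B : 'M[k]_n) (C : 'M[k]_p) :
  isometric A B -> isometric B C -> isometric A C.
Proof.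
case/isometricP=> P [Q [PQ QP <-]] /isometricP[P' [Q' [PQ' QP' <-]]].
apply: (@isometricE _ _ _ _ (P *m P') (Q' *m Q)).
- by rewrite mulmxA -[P *m P' *m Q']mulmxA PQ' mulmx1.
- by rewrite mulmxA -[Q' *m Q *m P]mulmxA QP mulmx1.
- by rewrite trmx_mul !mulmxA.
Qed.

Lemma isometric_reindex m n (A : 'M[k]_m) (B : 'M[k]_n) (f : 'I_m -> 'I_n) :
  bijective f -> (forall i j, A i j = B (f i) (f j)) -> isometric A B.
Proof.
case=> g fK gK AB.
apply: (@isometricE _ _ _ _ (rowsub f 1%:M) (rowsub g 1%:M)).
- by rewrite mul_rowsub_mx mul1mx; apply/matrixP=> i j; rewrite !mxE fK.
- by rewrite mul_rowsub_mx mul1mx; apply/matrixP=> i j; rewrite !mxE gK.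
rewrite mul_rowsub_mx mul1mx; apply/matrixP=> i j; rewrite AB !mxE.
rewrite (bigD1 (f j)) //= !mxE eqxx mulr1 big1 ?addr0 // => l lf.
by rewrite !mxE eq_sym (negPf lf) mulr0.
Qed.

Definition dsum_mx m n (A : 'M[k]_m) (B : 'M[k]_n) : 'M[k]_(m + n) :=
  block_mx A 0 0 B.

Lemma isometric_dsum m m' n n' (A : 'M[k]_m) (A' : 'M[k]_m')
    (B : 'M[k]_n) (B' : 'M[k]_n') :
  isometric A A' -> isometric B B' ->
  isometric (dsum_mx A B) (dsum_mx A' B').
Proof.
case/isometricP=> P [Q [PQ QP <-]] /isometricP[P' [Q' [PQ' QP' <-]]].
apply: (@isometricE _ _ _ _ (block_mx P 0 0 P') (block_mx Q 0 0 Q')).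
- by rewrite mulmx_block !(mul0mx, mulmx0, addr0, add0r) PQ PQ' -scalar_mx_block.
- by rewrite mulmx_block !(mul0mx, mulmx0, addr0, add0r) QP QP' -scalar_mx_block.
by rewrite tr_block_mx !trmx0 !mulmx_block !(mul0mx, mulmx0, addr0, add0r).
Qed.

Lemma tens1mx1 m n : (1%:M : 'M[k]_m) *t (1%:M : 'M[k]_n) = 1%:M.
Proof.
apply/matrixP=> i j; case: (mxtens_indexP i) => a b.
case: (mxtens_indexP j) => c d; rewrite tensmxE !mxE.
by rewrite (can_eq (@mxtens_indexK m n)) xpair_eqE -natrM mulnb.
Qed.

Lemma isometric_tens m m' n n' (A : 'M[k]_m) (A' : 'M[k]_m')
    (B : 'M[k]_n) (B' : 'M[k]_n') :
  isometric A A' -> isometric B B' -> isometric (A *t B) (A' *t B').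
Proof.
case/isometricP=> P [Q [PQ QP <-]] /isometricP[P' [Q' [PQ' QP' <-]]].
apply: (@isometricE _ _ _ _ (P *t P') (Q *t Q')).
- by rewrite tensmx_mul PQ PQ' tens1mx1.
- by rewrite tensmx_mul QP QP' tens1mx1.
by rewrite trmx_tens !tensmx_mul.
Qed.

Lemma isometric_dsumA m n p (A : 'M[k]_m) (B : 'M[k]_n) (C : 'M[k]_p) :
  isometric (dsum_mx A (dsum_mx B C)) (dsum_mx (dsum_mx A B) C).
Proof.
apply: (@isometric_reindex _ _ _ _ (cast_ord (addnA m n p))).
  by exists (cast_ord (esym (addnA m n p))) => i; rewrite ?cast_ordK ?cast_ordKV.
move=> i j; rewrite /dsum_mx -[in LHS]row_mx0 -[in LHS]col_mx0 block_mxA.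
by rewrite castmxE !esymK col_mx0 row_mx0.
Qed.

Lemma isometric_dsumC m n (A : 'M[k]_m) (B : 'M[k]_n) :
  isometric (dsum_mx A B) (dsum_mx B A).
Proof.
apply: (@isometricE _ _ _ _ (block_mx 0 1%:M 1%:M 0) (block_mx 0 1%:M 1%:M 0));
  rewrite /dsum_mx ?tr_block_mx ?trmx0 ?trmx1 !mulmx_block
    !(mul0mx, mulmx0, addr0, add0r, mul1mx, mulmx1) -?scalar_mx_block //.
Qed.

Lemma isometric_dsum0 n (O : 'M[k]_0) (A : 'M[k]_n) :
  isometric (dsum_mx O A) A.
Proof.
apply: (@isometricE _ _ _ _ (col_mx 0 1%:M) (row_mx 0 1%:M)).
- rewrite mul_col_row !(mul0mx, mulmx0, mul1mx).
  rewrite [RHS]scalar_mx_block; congr block_mx; apply/matrixP=> i j; by [case: i|case: j].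
- by rewrite mul_row_col mul0mx mul1mx add0r.
rewrite tr_col_mx trmx0 trmx1 mul_col_mx mul_col_row.
rewrite !(mul0mx, mulmx0, mul1mx, mulmx1).
congr block_mx; apply/matrixP=> i j; by [case: i|case: j].
Qed.

Lemma isometric_tensA m n p (A : 'M[k]_m) (B : 'M[k]_n) (C : 'M[k]_p) :
  isometric (A *t (B *t C)) ((A *t B) *t C).
Proof.
pose f (i : 'I_(m * (n * p))) := let: (a, u) := mxtens_unindex i in
  let: (b, c) := mxtens_unindex u in mxtens_index (mxtens_index (a, b), c).
pose g (i : 'I_(m * n * p)) := let: (u, c) := mxtens_unindex i in
  let: (a, b) := mxtens_unindex u in mxtens_index (a, mxtens_index (b, c)).
apply: (@isometric_reindex _ _ _ _ f).
  exists g => i; case: (mxtens_indexP i) => a b.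
    by case: (mxtens_indexP b) => c d; rewrite /f /g !mxtens_indexK.
  by case: (mxtens_indexP a) => c d; rewrite /f /g !mxtens_indexK.
move=> i j; case: (mxtens_indexP i) => a u; case: (mxtens_indexP u) => b c.
case: (mxtens_indexP j) => a' u'; case: (mxtens_indexP u') => b' c'.
by rewrite /f !mxtens_indexK !tensmxE mulrA.
Qed.

Lemma isometric_tensC m n (A : 'M[k]_m) (B : 'M[k]_n) :
  isometric (A *t B) (B *t A).
Proof.
pose f p q (i : 'I_(p * q)) := let: (a, b) := mxtens_unindex i in
  mxtens_index (b, a).
apply: (@isometric_reindex _ _ _ _ (@f m n)).
  exists (@f n m) => i; case: (mxtens_indexP i) => a b;
  by rewrite /f !mxtens_indexK.
move=> i j; case: (mxtens_indexP i) => a b; case: (mxtens_indexP j) => c d.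
by rewrite /f !mxtens_indexK !tensmxE mulrC.
Qed.

Lemma isometric_tens1 n (A : 'M[k]_n) : isometric ((1%:M : 'M_1) *t A) A.
Proof.
apply: (@isometric_reindex _ _ _ _ (fun i => (mxtens_unindex i).2)).
  exists (fun i => mxtens_index (0, i)) => i; last by rewrite mxtens_indexK.
  by case: (mxtens_indexP i) => a b; rewrite mxtens_indexK [a]ord1.
move=> i j; case: (mxtens_indexP i) => a b; case: (mxtens_indexP j) => c d.
by rewrite tensmxE !mxtens_indexK [a]ord1 [c]ord1 mxE mul1r.
Qed.

Lemma isometric_tensD m n p (A : 'M[k]_m) (B : 'M[k]_n) (C : 'M[k]_p) :
  isometric (dsum_mx A B *t C) (dsum_mx (A *t C) (B *t C)).
Proof.
pose f (i : 'I_((m + n) * p)) := let: (u, c) := mxtens_unindex i in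
  match split u with
  | inl a => lshift (n * p) (mxtens_index (a, c))
  | inr b => rshift (m * p) (mxtens_index (b, c)) end.
pose g (i : 'I_(m * p + n * p)) := match split i with
  | inl u => let: (a, c) := mxtens_unindex u in mxtens_index (lshift n a, c)
  | inr u => let: (b, c) := mxtens_unindex u in mxtens_index (rshift m b, c)
  end.
have splitl q r (i : 'I_q) : split (lshift r i) = inl i := unsplitK (inl i).
have splitr q r (i : 'I_r) : split (rshift q i) = inr i := unsplitK (inr i).
have fl a c : f (mxtens_index (lshift n a, c)) = lshift _ (mxtens_index (a, c)).
  by rewrite /f mxtens_indexK splitl.
have fr b c : f (mxtens_index (rshift m b, c)) = rshift _ (mxtens_index (b, c)).
  by rewrite /f mxtens_indexK splitr.
have splitE q r (i : 'I_(q + r)) :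
    (exists a, i = lshift r a) \/ (exists b, i = rshift q b).
  by rewrite -[i]splitK; case: (split i) => a; [left|right]; exists a.
apply: (@isometric_reindex _ _ _ _ f).
  exists g => i.
    case: (mxtens_indexP i) => u c.
    by case: (splitE _ _ u) => -[a ->];
      rewrite ?fl ?fr /g ?splitl ?splitr mxtens_indexK.
  case: (splitE _ _ i) => -[u ->]; case: (mxtens_indexP u) => a c;
  by rewrite /g ?splitl ?splitr mxtens_indexK ?fl ?fr.
move=> i j; case: (mxtens_indexP i) => u c; case: (mxtens_indexP j) => v d.
rewrite tensmxE /dsum_mx.
by case: (splitE _ _ u) => -[a ->]; case: (splitE _ _ v) => -[b ->];
  rewrite ?fl ?fr !(block_mxEul, block_mxEur, block_mxEdl, block_mxEdr)
    ?tensmxE ?mxE ?mul0r.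
Qed.

Definition sbform_iso (A B : sbform k) := isometric A B.

Lemma dsum_sym (A B : sbform k) : (dsum_mx A B)^T = dsum_mx A B.
Proof. by rewrite tr_block_mx !trmx0 !sbf_sym. Qed.
Lemma dsum_unit (A B : sbform k) : dsum_mx A B \in unitmx.
Proof. by rewrite unitmxE det_ublock unitrM -!unitmxE !sbf_unit. Qed.
Definition sbform_add (A B : sbform k) := SBForm (dsum_sym A B) (dsum_unit A B).

Lemma tens_sym (A B : sbform k) : (A *t B)^T = A *t B.
Proof. by rewrite trmx_tens !sbf_sym. Qed.
Lemma tens_unit (A B : sbform k) : A *t B \in unitmx.
Proof.
suff /mulmx1_unit[] : (A *t B) *m (invmx A *t invmx B) = 1%:M by [].
by rewrite tensmx_mul !mulmxV ?sbf_unit // tens1mx1.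
Qed.
Definition sbform_mul (A B : sbform k) := SBForm (tens_sym A B) (tens_unit A B).

Definition sbform_id n := SBForm (trmx1 k n) (unitmx1 k n).

Lemma sbform_mul0 (A : sbform k) :
  sbform_iso (sbform_mul (sbform_id 0) A) (sbform_id 0).
Proof.
apply: (@isometric_reindex _ _ _ _ (fun i => (mxtens_unindex i).1)).
  by exists (fun i : 'I_0 => cast_ord (esym (mul0n _)) i) => -[].
by move=> [].
Qed.

Definition sbform_rig : rig_upto := {|
  riso := sbform_iso; radd := sbform_add; rmul := sbform_mul;
  rzero := sbform_id 0; rone := sbform_id 1;
  riso_refl := fun A => isometric_refl A;
  riso_sym := fun A B => @isometric_sym _ _ A B;
  riso_trans := fun A B C => @isometric_trans _ _ _ A B C;
  radd_iso := fun A A' B B' => @isometric_dsum _ _ _ _ A A' B B';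
  rmul_iso := fun A A' B B' => @isometric_tens _ _ _ _ A A' B B';
  raddA := fun A B C => isometric_dsumA A B C;
  raddC := fun A B => isometric_dsumC A B;
  radd0 := fun A => isometric_dsum0 _ A;
  rmulA := fun A B C => isometric_tensA A B C;
  rmulC := fun A B => isometric_tensC A B;
  rmul1 := fun A => isometric_tens1 A;
  rmulD := fun A B C => isometric_tensD A B C;
  rmul0 := sbform_mul0 |}.

Definition GW := groth (iso_class sbform_rig).
HB.instance Definition _ := GRing.ComPzRing.on GW.

Definition GW_class (A : sbform k) : GW :=
  to_groth (to_iso_class (A : sbform_rig)).

End Forms.

(* The trace over k of the endomorphism x |-> a * x of E.                     *)
Definition ext_trace (k : fieldType) (L : fieldExtType k) (E : {vspace L})
    (a : L) : k :=
  \tr (\matrix_(i, j < \dim E) coord (vbasis E) j (a * (vbasis E)`_i)).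

Section TraceForm.
Variables (k : fieldType) (L : splittingFieldType k) (galL : galois 1 {:L}).
Variable H : {group gal_of {:L}}.

Local Notation E := (fixedField H).
Local Notation n := (\dim E).
Local Notation e := (vbasis E).

(* The Gram matrix of (x, y) |-> tr_{E/k} (x * y) in a basis of E = L^H.      *)
Definition trace_form_mx : 'M[k]_n :=
  \matrix_(i, j) ext_trace E (e`_i * e`_j).

Lemma gal1T : 'Gal({:L} / 1)%g = [set: gal_of {:L}].
Proof.
apply/setP=> x; rewrite inE gal_kHom ?sub1v //.
by apply/kAHomP=> _ /vlineP[c ->]; rewrite linearZ /= rmorph1.
Qed.

Lemma card_coset_space : #|{: coset_space H}| = n.
Proof.
rewrite card_sig -[LHS]/#|(rcosets H [set: gal_of {:L}] : {set _})|.
have := dim_fixed_galois galL (G := H).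
by rewrite gal1T subsetT dimv1 divn1 => ->.
Qed.

Let f (j : 'I_n) : coset_space H := enum_val (cast_ord (esym card_coset_space) j).
Let f' (C : coset_space H) : 'I_n := cast_ord card_coset_space (enum_rank C).
Let fK : cancel f f'.
Proof. by move=> j; rewrite /f /f' enum_valK cast_ordKV. Qed.
Let f'K : cancel f' f.
Proof. by move=> j; rewrite /f /f' cast_ordK enum_rankK. Qed.

Let g (j : 'I_n) : gal_of {:L} := fingroup.repr (val (f j)).
Let gE j : (H :* g j)%g = val (f j).
Proof. by rewrite /g; case: (f j) => C /= /rcosetsP[x _ ->]; rewrite rcoset_repr. Qed.

Let coset_subproof x : (H :* x)%g \in rcosets H [set: gal_of {:L}].
Proof. by rewrite mem_rcosets mulSGid ?subsetT ?inE. Qed.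

Let eE i : e`_i \in E.
Proof.
have [lt_in|ge_in] := ltnP i n; last by rewrite nth_default ?mem0v ?size_tuple.
by apply: vbasis_mem; rewrite mem_nth ?size_tuple.
Qed.

Let M : 'M[L]_n := \matrix_(i, j) g j e`_i.

Let M_unit : M \in unitmx.
Proof.
rewrite -unitmx_tr -row_free_unit -kermx_eq0; apply/rowV0P=> v /sub_kermxP vM.
have vE x : x \in E -> \sum_j v 0 j * g j x = 0.
  move=> Ex; rewrite (coord_vbasis Ex).
  under eq_bigr => j _ do rewrite linear_sum mulr_sumr.
  rewrite exchange_big big1 // => i _ /=.
  move/matrixP/(_ 0 i): vM; rewrite !mxE => vM.
  rewrite -[RHS](mulr0 ((coord e i x)%:A : L)) -[in RHS]vM mulr_sumr.
  apply: eq_bigr => j _; rewrite linearZ /= !mxE.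
  by rewrite mulr_algl -scalerAr.
pose q x : coset_space H := Sub (H :* x)%g (coset_subproof x).
pose c x := v 0 (f' (q x)).
have c0 x : c x = 0.
  apply: (@gal_independent _ _ {:L}%AS xpredT c) => // y _.
  have Ey : galTrace E {:L} y \in E.
    by rewrite mem_galTrace ?fixedField_galois ?memvf.
  rewrite -[RHS](vE _ Ey).
  rewrite (partition_big (fun x => f' (q x)) xpredT) //=.
  apply: eq_bigr => j _; rewrite rmorph_sum mulr_sumr /=.
  rewrite (reindex_inj (mulIg (g j))) /= gal_fixedField.
  apply: eq_big => [h|h /eqP hj]; last by rewrite /c hj galM ?memvf.
  rewrite (can2_eq f'K fK) -val_eqE /= -gE.
  by rewrite (sameP eqP rcoset_eqP) mem_rcoset mulgK.
apply/rowP=> j; rewrite [RHS]mxE -(c0 (g j)) /c.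
by congr (v 0 _); rewrite -[LHS]fK; congr f'; apply: val_inj; rewrite /= gE.
Qed.

Lemma ext_traceE a : a \in E -> (ext_trace E a)%:A = \sum_j g j a.
Proof.
move=> Ea; rewrite /ext_trace; set A := (X in \tr X).
have AM : map_mx (in_alg L) A *m M = M *m diag_mx (\row_j g j a).
  apply/matrixP=> i j; rewrite mul_mx_diag !mxE -rmorphM [_`_i * a]mulrC.
  rewrite [in RHS](coord_vbasis (rpredM Ea (eE i))) rmorph_sum /=.
  by apply: eq_bigr => l _; rewrite /A !mxE linearZ /= mulr_algl.
have -> : (\tr A)%:A = \tr (map_mx (in_alg L) A) :> L.
  by rewrite trace_map_mx.
rewrite -[map_mx _ A]mulmx1 -(mulmxV M_unit) mulmxA AM mxtrace_mulC mulmxA.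
by rewrite mulVmx // mul1mx mxtrace_diag; apply: eq_bigr => j _; rewrite mxE.
Qed.

Lemma trace_form_sym : trace_form_mx^T = trace_form_mx.
Proof. by apply/matrixP=> i j; rewrite !mxE mulrC. Qed.

Lemma trace_form_unit : trace_form_mx \in unitmx.
Proof.
rewrite -(map_unitmx (in_alg L)).
suff -> : map_mx (in_alg L) trace_form_mx = M *m M^T.
  by rewrite unitmx_mul unitmx_tr M_unit.
apply/matrixP=> i j; rewrite !mxE /= ext_traceE ?rpredM ?eE //.
by apply: eq_bigr => l _; rewrite !mxE rmorphM.
Qed.

Definition trace_form : sbform k := SBForm trace_form_sym trace_form_unit.

End TraceForm.

(* The value of h_{L/k} on the orbits, which determines the ring homomorphism *)
(* h_{L/k}. All elements of gal_of {:L} fix k (gal1T), so that gal_of {:L} is *)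
(* the Galois group of L/k; fixedField H is L^H. Since (x * y) a = y (x a) in *)
(* gal_of {:L}, its right actions are the left actions of the group of        *)
(* automorphisms under composition.                                           *)
Definition sends_orbits_to_trace_forms (k : fieldType)
    (L : splittingFieldType k) (galL : galois 1 {:L})
    (h : burnside (gal_of {:L}) -> GW k) : Prop :=
  forall H : {group gal_of {:L}},
    h (burnside_class (orbit_act H)) = GW_class (trace_form galL H).

Definition perfect_field (k : fieldType) : Prop :=
  forall p : {poly k}, irreducible_poly p -> separable_poly p.

Definition quadratically_closed (k : fieldType) : Prop :=
  forall x : k, exists y : k, x = y ^+ 2.

(* [k^* : (k^* )^2] = n: r enumerates representatives of the n cosets.        *)
Definition square_index (k : fieldType) (n : nat) : Prop :=
  exists r : 'I_n -> k, (forall i, r i != 0) /\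
    (forall x, x != 0 -> exists! i, exists2 y, y != 0 & x = r i * y ^+ 2).

Definition euclidean_field (k : fieldType) : Prop :=
  ~ (exists s : seq k, -1 = \sum_(x <- s) x ^+ 2) /\ square_index k 2.

(* Main.v *)
Require Import Defs.
From HB Require Import structures.
From mathcomp Require Import all_boot all_order all_algebra.
From mathcomp Require Import all_fingroup all_solvable all_field.
From mathcomp Require Import mxtens boolp ring zify.

Set Implicit Arguments.
Unset Strict Implicit.
Unset Printing Implicit Defensive.

Import GRing.Theory.
Local Open Scope ring_scope.

(* A finite G-set T is sent to the form \sum_x f x * g x on the k-space of    *)
(* equivariant functions f, g : T -> L; on G/H this is the trace form of L^H, *)
(* and orbits generate A(G), which gives existence and uniqueness of h.       *)
(* In GW(k), every form q satisfies q * H = rank q * H for the hyperbolic     *)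
(* plane H = <1> + <-1>. If h is bijective and h y = H, then in A(G)          *)
(* [G] * y = #|G| * y, whereas [G] * y = 2 * [G] since h preserves ranks;     *)
(* counting orbits, #|G| divides 2. If #|G| = 1, all <a> are <1>, hence all a *)
(* are squares by the discriminant. If #|G| = 2, the only possible <a> are    *)
(* <1> and h [G] - <1>, and 2<-1> <> 2<1>, which forces k to be euclidean.    *)
(* Conversely GW(k) is generated by the <a>; over a euclidean field these are *)
(* <1> and <-1>, independent by inertia, and the trace form of k[i] is H.     *)

(** Galois descent turns a finite $G$-set [T] into a form of rank [#|T|] on the equivariant
    functions [T -> L]. Disjoint unions become orthogonal sums, products become tensor products, and
    the isometry class is well defined ([descends_unique]); hence a ring homomorphism [h] that
    carries cardinality to rank ([trace_form_morphism], [rank_h]).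

    Necessity compares two absorbing elements: multiplication by the regular set $[G]$ in $A(G)$
    remembers only cardinality ([mul_reg]), and multiplication by $1 + <-1>$ in $GW(k)$ remembers
    only rank ([GW_mul_hyperbolic]). If [h y] is the hyperbolic plane, $[G] y$ is both $2[G]$ and
    $|G| y$, and counting orbits gives $|G|$ dividing 2 ([card_gal_dvd2]). When $|G| = 1$, ranks
    force $<a> = <1>$ and the discriminant makes $a$ a square. When $|G| = 2$, the only elements of
    $A(G)$ with cardinality 1 and square 1 are $1$ and $[G] - 1$, so there are at most two square
    classes ([rank_one_dichotomy]); [N1_not_torsion] keeps $-1$ from being a sum of two squares, and
    then [euclidean_criterion] and [quadratic_i] conclude.

    For sufficiency, rank one forms generate $GW(k)$ ([GW_class_ind]). Over a euclidean field these
    are $1$ and $<-1>$, independent by inertia ([GW_N1_torsion]), and $h[G] = 1 + <-1>$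
    ([trace_form_i]), so a basis goes to a basis. *)

Local Notation orbit_act := Defs.orbit_act.

(** * Maps out of a Grothendieck ring *)

Section GrothendieckLift.
Variables (S : rig_upto) (V : zmodType) (f : S -> V).
Hypotheses (f_iso : forall X Y : S, riso X Y -> f X = f Y).
Hypotheses (fD : forall X Y : S, f (radd X Y) = f X + f Y).

Definition iso_class_lift (x : iso_class S) : V := f (generic_quotient.repr x).

Lemma iso_class_liftE (X : S) : iso_class_lift (to_iso_class X) = f X.
Proof. exact/f_iso/repr_to_iso_class. Qed.

Lemma iso_class_liftD : {morph iso_class_lift : x y / x + y}.
Proof.
elim/iso_class_ind=> X; elim/iso_class_ind=> Y.
by rewrite -to_iso_classD !iso_class_liftE.
Qed.

Definition groth_lift (z : groth (iso_class S)) : V :=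
  let: (a, b) := generic_quotient.repr z in iso_class_lift a - iso_class_lift b.

(** Pairs with the same formal difference agree up to a common summand [e], which cancels because
    [V] is a group. *)
Lemma groth_lift_gdiff a b :
  groth_lift (gdiff a b) = iso_class_lift a - iso_class_lift b.
Proof.
rewrite /groth_lift; have := repr_gdiff a b.
case: (generic_quotient.repr _) => c d /= [e] /(congr1 iso_class_lift).
rewrite !iso_class_liftD => /addIr E.
by apply/eqP; rewrite subr_eq addrAC -E addrK.
Qed.

Lemma groth_liftE (X : S) : groth_lift (to_groth (to_iso_class X)) = f X.
Proof.
rewrite groth_lift_gdiff iso_class_liftE.
suff -> : iso_class_lift 0 = 0 by rewrite subr0.
by apply: (addrI (iso_class_lift 0)); rewrite -iso_class_liftD !addr0.
Qed.

Lemma gdiffD (M : comPzSemiRingType) (a b c d : M) :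
  gdiff a b + gdiff c d = gdiff (a + c) (b + d).
Proof. exact: groth_addE. Qed.

Lemma gdiffM (M : comPzSemiRingType) (a b c d : M) :
  gdiff a b * gdiff c d = gdiff (a * c + b * d) (a * d + b * c).
Proof. exact: groth_mulE. Qed.

Lemma groth_liftD : {morph groth_lift : x y / x + y}.
Proof.
elim/groth_ind=> a b; elim/groth_ind=> c d.
by rewrite gdiffD !groth_lift_gdiff !iso_class_liftD opprD addrACA.
Qed.

Lemma groth_liftB : zmod_morphism groth_lift.
Proof.
have N x : groth_lift (- x) = - groth_lift x.
  apply: (addrI (groth_lift x)); rewrite -groth_liftD !subrr.
  by apply: (addrI (groth_lift 0)); rewrite -groth_liftD !addr0.
by move=> x y; rewrite groth_liftD N.
Qed.

End GrothendieckLift.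

Lemma gdiffE (M : comPzSemiRingType) (a b : M) :
  gdiff a b = to_groth a - to_groth b.
Proof.
apply/eqP; rewrite eq_sym subr_eq; apply/eqP.
by rewrite gdiffD; apply/gdiffP; exists 0; rewrite !addr0.
Qed.

Lemma to_grothD (M : comPzSemiRingType) (a b : M) :
  to_groth (a + b) = to_groth a + to_groth b.
Proof. by rewrite [RHS]gdiffD addr0. Qed.
Lemma to_grothM (M : comPzSemiRingType) (a b : M) :
  to_groth (a * b) = to_groth a * to_groth b.
Proof. by rewrite [RHS]gdiffM !mulr0 !mul0r !addr0. Qed.

Lemma groth_iso_ind (S : rig_upto) (P : groth (iso_class S) -> Prop) :
  (forall X Y : S, P (to_groth (to_iso_class X) - to_groth (to_iso_class Y))) ->
  forall z, P z.
Proof.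
move=> PB; elim/groth_ind; elim/iso_class_ind=> X; elim/iso_class_ind=> Y.
by rewrite gdiffE.
Qed.

Section GrothendieckRingLift.
Variables (S : rig_upto) (V : comPzRingType) (f : S -> V).
Hypotheses (f_iso : forall X Y : S, riso X Y -> f X = f Y).
Hypotheses (fD : forall X Y : S, f (radd X Y) = f X + f Y).
Hypotheses (fM : forall X Y : S, f (rmul X Y) = f X * f Y).
Hypotheses (f1 : f (rone S) = 1).

Lemma groth_ring_lift : exists h : {rmorphism groth (iso_class S) -> V},
  forall X : S, h (to_groth (to_iso_class X)) = f X.
Proof.
pose g := groth_lift f.
have gM : {morph g : x y / x * y}.
  have iM : {morph iso_class_lift f : x y / x * y}.
    elim/iso_class_ind=> X; elim/iso_class_ind=> Y.
    by rewrite -to_iso_classM !iso_class_liftE.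
  elim/groth_ind=> a b; elim/groth_ind=> c d; rewrite /g gdiffM.
  by rewrite !groth_lift_gdiff // !iso_class_liftD // !iM; ring.
have g1 : g 1 = 1 by rewrite /g [LHS](groth_liftE f_iso fD).
have gB : zmod_morphism g by apply: groth_liftB.
pose gZ := GRing.isZmodMorphism.Build _ _ g gB.
pose gR := GRing.isMonoidMorphism.Build _ _ g (conj g1 gM).
pose h : {rmorphism _ -> _} := HB.pack g gZ gR.
by exists h => X; rewrite /= /g groth_liftE.
Qed.

End GrothendieckRingLift.

(** * The Burnside ring *)

Section OrbitDecomposition.
Variable gT : finGroupType.

Section SubAction.
Variables (T : finType) (to : {action gT &-> T}) (p : pred T).
Hypothesis p_act : forall x a, p (to x a) = p x.

Definition sub_act_fun (u : {x | p x}) (a : gT) : {x | p x} :=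
  Sub (to (val u) a) (etrans (p_act (val u) a) (valP u)).
Lemma sub_act_fun1 : sub_act_fun ^~ 1%g =1 id.
Proof. by move=> u; apply: val_inj; rewrite /= act1. Qed.
Lemma sub_act_funM : forall u, act_morph sub_act_fun u.
Proof. by move=> u a b; apply: val_inj; rewrite /= actM. Qed.
Definition sub_act : {action gT &-> {x | p x}} :=
  TotalAction sub_act_fun1 sub_act_funM.

End SubAction.

Lemma sub_act_split (T : finType) (to : {action gT &-> T}) (p : pred T)
    (p_act : forall x a, p (to x a) = p x)
    (pC_act : forall x a, predC p (to x a) = predC p x) :
  act_iso (sum_act (sub_act p_act) (sub_act pC_act)) to.
Proof.
pose split x : {x | p x} + {x | predC p x} := match boolP (p x) with
  | AltTrue h => inl (Sub x h) | AltFalse h => inr (Sub x h) end.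
exists (fun u => match u with inl u => val u | inr u => val u end);
  last by case.
exists split; last by move=> x; rewrite /split; case: {-}_ / (boolP (p x)).
case=> -[x px]; rewrite /split /=; case: {-}_ / (boolP (p x)) => h.
- by congr inl; apply: val_inj.
- by case/negP: h.
- by case/negP: px.
by congr inr; apply: val_inj.
Qed.

(** Orbit-stabiliser for right actions: the right coset of the stabiliser through [a] corresponds to
    [to x a], and [amove] gives the inverse. *)
Lemma orbit_act_iso (T : finType) (to : {action gT &-> T}) (x : T)
    (O_act : forall y a,
      (to y a \in orbit to [set: gT] x) = (y \in orbit to [set: gT] x)) :
  act_iso (orbit_act 'C_[set: gT][x | to]%G) (sub_act O_act).
Proof.
have reprE a : to x (fingroup.repr ('C_[set: gT][x | to] :* a)%g) = to x a.
  case: repr_rcosetP => h /setIP[_ /astab1P hx].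
  by rewrite actM hx.
have fP (C : coset_space 'C_[set: gT][x | to]%G) :
    to x (fingroup.repr (val C)) \in orbit to [set: gT] x.
  by apply: mem_orbit; rewrite inE.
have gP (u : {y | y \in orbit to [set: gT] x}) :
    amove to [set: gT] x (val u) \in rcosets 'C_[set: gT][x | to]%G [set: gT].
  by rewrite -amove_orbit ?subsetT // imset_f // (valP u).
exists (fun C => exist (fun y => y \in orbit to _ x) _ (fP C)).
  exists (fun u =>
    exist (fun C : {set gT} => C \in rcosets _ [set: gT]) _ (gP u)).
    by move=> C; apply: val_inj; apply: act_reprK (subsetT _) _ (valP C).
  case=> y yO; apply: val_inj => /=; case/orbitP: (yO) => a _ <-.
  by rewrite amove_act ?inE ?subsetT.
case=> C CP a; apply: val_inj => /=; case/rcosetsP: CP => b _ ->.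
by rewrite -rcosetM !reprE actM.
Qed.

(** Orbits are peeled off one at a time; the splitting holds only up to isomorphism, so [P] must be
    invariant under it. *)
Lemma act_ind (P : forall T : finType, {action gT &-> T} -> Prop) :
  (forall (T U : finType) (to : {action gT &-> T}) (to' : {action gT &-> U}),
     act_iso to to' -> P T to -> P U to') ->
  P void (empty_act gT) ->
  (forall (H : {group gT}) (T : finType) (to : {action gT &-> T}),
     P T to -> P _ (sum_act (orbit_act H) to)) ->
  forall (T : finType) (to : {action gT &-> T}), P T to.
Proof.
move=> P_iso P0 PD T to.
have [n] := ubnP #|T|; elim: n T to => // n IHn T to.
have [x _|T0] := pickP (@predT T); last first.
  move=> _; apply: P_iso P0.
  exists (of_void T); last by case.
  exists (fun x => False_rect void (elimF idP (T0 x) isT)); first by case.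
  by move=> x; case: (elimF idP (T0 x)).
rewrite ltnS => leTn.
pose p := [pred y | y \in orbit to [set: gT] x].
have p_act y a : p (to y a) = p y by rewrite /= orbit_actr ?inE.
have pC_act y a : predC p (to y a) = predC p y.
  exact: (congr1 negb (p_act y a)).
apply: (P_iso) (sub_act_split p_act pC_act) _.
apply: P_iso (sum_act_iso (orbit_act_iso p_act) (act_iso_refl _)) _.
apply/PD/IHn; apply: leq_trans leTn; rewrite card_sig.
apply/proper_card/properP; split; first exact/subsetP.
by exists x; rewrite ?inE //= orbit_refl.
Qed.

Implicit Types (T U : finType).

Lemma burnside_class_iso T U (to : {action gT &-> T}) (to' : {action gT &-> U}) :
  act_iso to to' -> burnside_class to = burnside_class to'.
Proof. by move=> i; congr to_groth; apply/iso_classP/gset_of_iso. Qed.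

Lemma burnside_class0 : burnside_class (empty_act gT) = 0.
Proof. by []. Qed.
Lemma burnside_class1 : burnside_class (triv_act gT) = 1.
Proof. by []. Qed.

Lemma burnside_classD T U (to : {action gT &-> T}) (to' : {action gT &-> U}) :
  burnside_class (sum_act to to') = burnside_class to + burnside_class to'.
Proof.
rewrite -[RHS]to_grothD -to_iso_classD; congr to_groth; apply/iso_classP.
by apply/gset_of_iso/sum_act_iso; apply/act_iso_sym/gset_ofP.
Qed.

Lemma burnside_classM T U (to : {action gT &-> T}) (to' : {action gT &-> U}) :
  burnside_class (prod_act to to') = burnside_class to * burnside_class to'.
Proof.
rewrite -[RHS]to_grothM -to_iso_classM; congr to_groth; apply/iso_classP.
by apply/gset_of_iso/prod_act_iso; apply/act_iso_sym/gset_ofP.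
Qed.

Lemma to_grothE (X : gset gT) :
  to_groth (to_iso_class (X : gset_rig gT)) = burnside_class X.
Proof.
by congr to_groth; apply/iso_classP/act_iso_sym/gset_ofP.
Qed.

Lemma burnside_ind (P : burnside gT -> Prop) :
  (forall (T : finType) (to : {action gT &-> T})
          (U : finType) (to' : {action gT &-> U}),
     P (burnside_class to - burnside_class to')) ->
  forall z, P z.
Proof. by move=> PB; elim/groth_iso_ind => X Y; rewrite !to_grothE. Qed.

Section BurnsideLift.
Variables (V : zmodType) (f : forall T, {action gT &-> T} -> V).
Hypothesis f_iso : forall T U (to : {action gT &-> T}) (to' : {action gT &-> U}),
  act_iso to to' -> f to = f to'.
Hypothesis fD : forall T U (to : {action gT &-> T}) (to' : {action gT &-> U}),
  f (sum_act to to') = f to + f to'.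

Lemma burnside_lift : {phi : {additive burnside gT -> V} |
  forall T (to : {action gT &-> T}), phi (burnside_class to) = f to}.
Proof.
pose g (X : gset_rig gT) := f (gset_act X).
have g_iso (X Y : gset_rig gT) : riso X Y -> g X = g Y by apply: f_iso.
have gD (X Y : gset_rig gT) : g (radd X Y) = g X + g Y.
  by rewrite -fD; apply/f_iso/gset_ofP.
pose gZ := GRing.isZmodMorphism.Build _ _ _ (groth_liftB g_iso gD).
pose phi : {additive burnside gT -> V} := HB.pack (groth_lift g) gZ.
exists phi => T to; rewrite /= [LHS](groth_liftE g_iso gD).
exact/f_iso/gset_ofP.
Qed.

End BurnsideLift.

Lemma card_additive : {phi : {additive burnside gT -> int} |
  forall T (to : {action gT &-> T}), phi (burnside_class to) = #|T|%:Z}.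
Proof.
apply: burnside_lift => [T U to to' [f fb _]|T U to to'].
  by rewrite (bij_eq_card fb).
by rewrite card_sum PoszD.
Qed.

Definition burnside_card : {additive burnside gT -> int} := sval card_additive.

Lemma burnside_cardE T (to : {action gT &-> T}) :
  burnside_card (burnside_class to) = #|T|%:Z.
Proof. exact: (svalP card_additive). Qed.

Definition orbits T (to : {action gT &-> T}) := orbit to [set: gT] @: [set: T].

(** Unlike cardinality, this invariant takes the value 1 on $[G]$, which is what lets it detect
    divisibility. *)
Lemma orbits_additive : {phi : {additive burnside gT -> int} |
  forall T (to : {action gT &-> T}), phi (burnside_class to) = #|orbits to|%:Z}.
Proof.
have orb_inj T U (to : {action gT &-> T}) (to' : {action gT &-> U}) (f : T -> U)
    : (forall x a, f (to x a) = to' (f x) a) -> forall x,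
    orbit to' [set: gT] (f x) = f @: orbit to [set: gT] x.
  move=> fE x; apply/setP=> y; apply/orbitP/imsetP=> [[a _ <-]|].
    by exists (to x a); rewrite ?fE ?mem_orbit ?inE.
  by case=> _ /orbitP[a _ <-] ->; exists a; rewrite ?inE ?fE.
apply: burnside_lift => [T U to to' [f [g fK gK] fE]|T U to to'].
  rewrite -(card_imset (mem (orbits to)) (imset_inj (can_inj fK))).
  congr (Posz _); apply: eq_card => O.
  apply/imsetP/imsetP=> [[_ /imsetP[x _ ->] ->]|[y _ ->]].
    by exists (f x); rewrite ?inE // (orb_inj _ _ _ _ _ fE).
  exists (orbit to [set: gT] (g y)); first by rewrite imset_f ?inE.
  by rewrite -(orb_inj _ _ _ _ _ fE) gK.
have inlE x a : inl (to x a) = sum_act to to' (inl x) a by [].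
have inrE x a : inr (to' x a) = sum_act to to' (inr x) a by [].
have inl_inj : injective (@inl T U) by move=> x y [].
have inr_inj : injective (@inr T U) by move=> x y [].
pose A := [set inl @: O | O : {set T} in orbits to] : {set {set T + U}}.
pose B := [set inr @: O | O : {set U} in orbits to'] : {set {set T + U}}.
rewrite -PoszD -(card_imset (mem (orbits to)) (imset_inj inl_inj)) -/A.
rewrite -(card_imset (mem (orbits to')) (imset_inj inr_inj)) -/B.
have -> : orbits (sum_act to to') = A :|: B.
  apply/setP=> O; rewrite in_setU; apply/imsetP/orP.
    case=> -[x|x] _ ->; [left|right].
      by rewrite (orb_inj _ _ _ _ _ inlE) !imset_f ?inE.
    by rewrite (orb_inj _ _ _ _ _ inrE) !imset_f ?inE.
  case=> /imsetP[_ /imsetP[x _ ->] ->].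
    by exists (inl x); rewrite ?inE // (orb_inj _ _ _ _ _ inlE).
  by exists (inr x); rewrite ?inE // (orb_inj _ _ _ _ _ inrE).
rewrite cardsU (_ : A :&: B = set0) ?cards0 ?subn0 //.
apply/setP=> O; rewrite !inE; apply/andP=> -[].
case/imsetP=> _ /imsetP[x _ ->] -> /imsetP[_ /imsetP[y _ ->]].
move/setP/(_ (inl x)); rewrite imset_f ?orbit_refl // => /esym/imsetP[].
by [].
Qed.

Definition burnside_orbits : {additive burnside gT -> int} :=
  sval orbits_additive.

Lemma burnside_orbitsE T (to : {action gT &-> T}) :
  burnside_orbits (burnside_class to) = #|orbits to|%:Z.
Proof. exact: (svalP orbits_additive). Qed.

Local Notation reg := (burnside_class (mulgr_action gT)).

Lemma orbit_act1_iso : act_iso (orbit_act 1%G) (mulgr_action gT).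
Proof.
have gP (a : gT) : (1%G :* a)%g \in rcosets 1%G [set: gT].
  by rewrite mem_rcosets mulSGid ?subsetT ?inE.
apply: act_iso_sym;
  exists (fun a => exist (fun C : {set gT} => C \in rcosets _ [set: gT]) _ (gP a));
  last first.
  by move=> a b; apply: val_inj; rewrite /= rcosetM.
exists (fun C => fingroup.repr (val C)) => [a|[C CP]].
  by rewrite /=; case: repr_rcosetP => h /set1P ->; rewrite mul1g.
apply: val_inj => /=; case/rcosetsP: CP => a _ ->.
by rewrite rcoset_repr.
Qed.

Lemma orbit_actT_iso : act_iso (orbit_act [set: gT]%G) (triv_act gT).
Proof.
have CP (C : coset_space [set: gT]%G) : val C = [set: gT].
  case: C => C /= /rcosetsP[a _ ->].
  by apply/setP=> x; rewrite mem_rcoset !inE.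
have TP : [set: gT] \in rcosets [set: gT]%G [set: gT].
  by apply/rcosetsP; exists 1%g; rewrite ?inE ?rcoset1.
exists (fun _ => tt) => //;
  exists (fun _ => exist (fun C : {set gT} => C \in rcosets _ [set: gT]) _ TP);
  last by case.
by move=> C; apply: val_inj; rewrite /= CP.
Qed.

(** The group [H] fixes its own coset in $G/H$, so every orbit of a free set has [H] trivial and is
    regular. *)
Lemma free_burnside_class T (to : {action gT &-> T}) :
  (forall x a, to x a = x -> a = 1%g) ->
  exists2 r : nat, burnside_class to = reg *+ r & #|T| = (#|gT| * r)%N.
Proof.
elim/act_ind: T / to => [T U to to' i IH free|_|H T to IH free].
- have [f fb fE] := i; have [x a /(congr1 f)|r E1 E2] := IH.
    by rewrite fE => /free.
  exists r; first by rewrite -(burnside_class_iso i).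
  by rewrite -(bij_eq_card fb).
- by exists 0; rewrite ?mulr0n ?card_void ?muln0.
have [x a E|r E1 E2] := IH; first by apply: (free (inr x)); rewrite /= E.
have HP : (H : {set gT}) \in rcosets H [set: gT].
  by apply/rcosetsP; exists 1%g; rewrite ?inE ?rcoset1.
have H1 : H = 1%G.
  apply/trivGP/subsetP=> a aH; apply/set1P.
  pose C : coset_space H := exist (fun C : {set gT} => C \in rcosets _ [set: gT]) _ HP.
  apply: (free (inl C)) => /=; congr inl.
  by apply: val_inj; rewrite /= rcoset_id.
have i1 : act_iso (orbit_act H) (mulgr_action gT).
  by rewrite H1; apply: orbit_act1_iso.
exists r.+1; first by rewrite burnside_classD (burnside_class_iso i1) E1 -mulrS.
by rewrite card_sum E2; case: i1 => f fb _; rewrite (bij_eq_card fb) mulnS.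
Qed.

(** The diagonal action on $T \times G$ is free, already on the second factor, so it is a sum of
    copies of $G$; cardinality counts them. *)
Lemma mul_reg z : z * reg = reg *~ burnside_card z.
Proof.
elim/burnside_ind: z => T to U to'.
have E (V : finType) (a : {action gT &-> V}) :
    burnside_class a * reg = reg *~ #|V|%:Z.
  rewrite -burnside_classM.
  have [[x b] c|r -> E] := @free_burnside_class _ (prod_act a (mulgr_action gT)).
    by case=> _ /eqP; rewrite -{2}[b]mulg1 (inj_eq (mulgI b)) => /eqP.
  move/eqP: E; rewrite card_prod mulnC eqn_pmul2l; first by move/eqP->.
  by apply/card_gt0P; exists 1%g.
by rewrite mulrBl !E raddfB /= !burnside_cardE mulrzBr.
Qed.

End OrbitDecomposition.

(** * The Grothendieck-Witt ring *)

Section GrothendieckWitt.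
Variable k : fieldType.
Implicit Types A B C E : sbform k.

Lemma GW_class_iso A B : isometric A B -> GW_class A = GW_class B.
Proof. by move=> i; congr to_groth; apply/iso_classP. Qed.

Lemma GW_classD A B : GW_class (sbform_add A B) = GW_class A + GW_class B.
Proof. by rewrite -[RHS]to_grothD -to_iso_classD. Qed.

Lemma GW_classM A B : GW_class (sbform_mul A B) = GW_class A * GW_class B.
Proof. by rewrite -[RHS]to_grothM -to_iso_classM. Qed.

Lemma GW_class1 : GW_class (sbform_id k 1) = 1.
Proof. by []. Qed.

Lemma GW_class_dim0 A : sbf_dim A = 0%N -> GW_class A = 0.
Proof.
case: A => -[|//] M sM uM _; apply: (@GW_class_iso _ (sbform_id k 0)).
by rewrite /= [M]flatmx0 [1%:M]flatmx0; apply: isometric_refl.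
Qed.

Lemma GW_ind (P : GW k -> Prop) :
  (forall A B, P (GW_class A - GW_class B)) -> forall z, P z.
Proof. by move=> PB; apply: (@groth_iso_ind (sbform_rig k)). Qed.

Lemma GW_class_eqP A B : GW_class A = GW_class B ->
  exists E, isometric (dsum_mx A E) (dsum_mx B E).
Proof.
case/gdiffP; elim/iso_class_ind=> E; rewrite !addr0 -!to_iso_classD.
by move/iso_classP => i; exists E.
Qed.

Lemma isometric_dim m n (A : 'M[k]_m) (B : 'M[k]_n) : isometric A B -> m = n.
Proof. by case=> P [/eqP rP /eqP cP _]; rewrite -rP -[RHS]cP. Qed.

Lemma isometric_unitmx m n (A : 'M[k]_m) (B : 'M[k]_n) :
  isometric A B -> B \in unitmx -> A \in unitmx.
Proof.
case/isometricP=> P [Q [PQ QP <-]] uB.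
suff /mulmx1_unit[] : P *m B *m P^T *m (Q^T *m invmx B *m Q) = 1%:M by [].
rewrite !mulmxA -[P *m B *m _ *m _]mulmxA -trmx_mul QP trmx1 mulmx1.
by rewrite mulmxK.
Qed.

Lemma dim_additive : {phi : {additive GW k -> int} |
  forall A, phi (GW_class A) = (sbf_dim A)%:Z}.
Proof.
pose d (A : sbform_rig k) := (sbf_dim A)%:Z.
have d_iso (A B : sbform_rig k) : riso A B -> d A = d B.
  by move/isometric_dim=> AB; rewrite /d AB.
have dD (A B : sbform_rig k) : d (radd A B) = d A + d B by [].
pose gZ := GRing.isZmodMorphism.Build _ _ _ (groth_liftB d_iso dD).
pose phi : {additive GW k -> int} := HB.pack (groth_lift d) gZ.
by exists phi => A; apply: (groth_liftE d_iso dD).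
Qed.

Definition GW_rank : {additive GW k -> int} := sval dim_additive.

Lemma GW_rankE A : GW_rank (GW_class A) = (sbf_dim A)%:Z.
Proof. exact: (svalP dim_additive). Qed.

Lemma GW_class_id n : GW_class (sbform_id k n) = n%:R.
Proof.
elim: n => [|n IHn]; first exact: GW_class_dim0.
rewrite -add1n natrD -IHn -GW_class1 -GW_classD; apply: GW_class_iso.
by rewrite /= /dsum_mx -scalar_mx_block; apply: isometric_refl.
Qed.

Lemma rank_one_sym (a : k) : (a%:M : 'M_1)^T = a%:M.
Proof. exact: tr_scalar_mx. Qed.
Lemma rank_one_unit (a : k) : a != 0 -> (a%:M : 'M_1) \in unitmx.
Proof. by rewrite unitmxE det_scalar1 unitfE. Qed.
Definition rank_one (a : k) (a0 : a != 0) : sbform k :=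
  SBForm (rank_one_sym a) (rank_one_unit a0).
Local Notation "<< a0 >>" := (GW_class (rank_one a0)).

Lemma isometric_rank_one (a b y : k) : y != 0 -> a = b * y ^+ 2 ->
  isometric (a%:M : 'M_1) (b%:M : 'M_1).
Proof.
move=> y0 ->; apply: (@isometricE _ _ _ _ _ y%:M y^-1%:M).
- by rewrite -scalar_mxM mulfV.
- by rewrite -scalar_mxM mulVf.
by rewrite tr_scalar_mx -!scalar_mxM; congr _%:M; ring.
Qed.

Lemma rank_one_eq (a b y : k) (a0 : a != 0) (b0 : b != 0) :
  y != 0 -> a = b * y ^+ 2 -> <<a0>> = <<b0>>.
Proof. by move=> y0 E; apply/GW_class_iso/(isometric_rank_one y0 E). Qed.

Lemma rank_one1 (a0 : 1 != 0 :> k) : <<a0>> = 1.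
Proof. exact/GW_class_iso/isometric_refl. Qed.

Lemma rank_one_sqr (a : k) (a0 : a != 0) : <<a0>> * <<a0>> = 1.
Proof.
rewrite -GW_classM -GW_class1; apply: GW_class_iso => /=.
apply: isometric_trans (isometric_rank_one (y := a) (b := 1) a0 erefl).
rewrite mul1r; apply: (@isometric_reindex _ _ _ _ _ (fun i => (mxtens_unindex i).1)).
  exists (fun i => mxtens_index (i, 0)) => i; last by rewrite mxtens_indexK.
  by case: (mxtens_indexP i) => c d; rewrite mxtens_indexK [d]ord1.
move=> i j; case: (mxtens_indexP i) => c d; case: (mxtens_indexP j) => c' d'.
by rewrite tensmxE !mxtens_indexK [c]ord1 [d]ord1 [c']ord1 [d']ord1 !mxE expr2.
Qed.

(* Stable isometry preserves the discriminant. *)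
Lemma rank_one_inj (a b : k) (a0 : a != 0) (b0 : b != 0) :
  <<a0>> = <<b0>> -> exists2 y, y != 0 & a = b * y ^+ 2.
Proof.
case/GW_class_eqP=> E [P [/= fP _]].
move/(congr1 determinant); rewrite !det_mulmx det_tr !det_ublock !det_scalar1.
have : \det E != 0 by rewrite -unitfE -unitmxE sbf_unit.
move=> E0 eq; exists (\det P).
  by rewrite -unitfE -unitmxE -row_free_unit.
by apply: (mulIf E0); rewrite -eq; ring.
Qed.

Lemma sbform_opp_sym A : (- (A : 'M_ _))^T = - (A : 'M_ _).
Proof. by rewrite linearN /= sbf_sym. Qed.
Lemma sbform_opp_unit A : - (A : 'M_ _) \in unitmx.
Proof. by rewrite -scaleN1r unitmxZ ?sbf_unit // unitrN1. Qed.
Definition sbform_opp A : sbform k := SBForm (sbform_opp_sym A) (sbform_opp_unit A).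

Lemma metabolic_sym A (B : 'M_(sbf_dim A)) : B^T = B ->
  (block_mx 0 A A B)^T = block_mx 0 A A B.
Proof. by move=> sB; rewrite tr_block_mx trmx0 sbf_sym sB. Qed.
Lemma metabolic_unit A (B : 'M_(sbf_dim A)) : block_mx 0 A A B \in unitmx.
Proof.
have uA := sbf_unit A.
suff /mulmx1_unit[] : block_mx 0 A A B *m
  block_mx (- invmx A *m B *m invmx A) (invmx A) (invmx A) 0 = 1%:M by [].
rewrite mulmx_block !(mul0mx, mulmx0, add0r, addr0) !mulmxV //.
by rewrite !mulNmx mulmxN !mulmxA mulmxV // mul1mx addNr -scalar_mx_block.
Qed.
(** The first half of the coordinates is totally isotropic of half the dimension. In characteristic
    two the block [B] can affect the isometry class. *)
Definition metabolic A (B : 'M_(sbf_dim A)) (sB : B^T = B) : sbform k :=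
  SBForm (metabolic_sym sB) (metabolic_unit B).

Lemma N1_neq0 : (-1 : k) != 0.
Proof. by rewrite oppr_eq0 oner_eq0. Qed.

Lemma GW_sbform_opp A : GW_class (sbform_opp A) = <<N1_neq0>> * GW_class A.
Proof.
rewrite -GW_classM; apply: GW_class_iso; apply: isometric_sym.
apply: (@isometric_reindex _ _ _ _ _ (fun i => (mxtens_unindex i).2)).
  exists (fun i => mxtens_index (0, i)) => i; last by rewrite mxtens_indexK.
  by case: (mxtens_indexP i) => a b; rewrite mxtens_indexK [a]ord1.
move=> i j; case: (mxtens_indexP i) => a b; case: (mxtens_indexP j) => c d.
by rewrite tensmxE !mxtens_indexK [a]ord1 [c]ord1 !mxE mulN1r.
Qed.

(** The diagonal is totally isotropic in the sum of [A] and [-A], and the first summand is a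
    complement of it. *)
Lemma isometric_sum_opp A :
  isometric (dsum_mx A (sbform_opp A)) (block_mx 0 A A (A : 'M_ _)).
Proof.
apply: isometric_sym; apply: (@isometricE _ _ _ _ _
  (block_mx 1%:M 1%:M 1%:M 0) (block_mx 0 1%:M 1%:M (- 1%:M))).
- rewrite mulmx_block !(mul0mx, mulmx0, mul1mx, mulmx1, add0r, addr0) addrN.
  by rewrite -scalar_mx_block.
- rewrite mulmx_block !(mul0mx, mulmx0, mul1mx, mulmx1, add0r, addr0) addrN.
  by rewrite -scalar_mx_block.
rewrite tr_block_mx !trmx0 !trmx1 !mulmx_block.
by rewrite !(mul0mx, mulmx0, mul1mx, mulmx1, add0r, addr0) /= addrN.
Qed.

(** With $e_3$ running over the summand [-A], the new vectors are $e_1$, $e_2 + e_3$ and $e_1 +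
    e_3$: adding $e_3$ cancels the block [A] on $e_2$, and adding $e_1$ to $e_3$ restores
    orthogonality. There is no division by two, so characteristic two is covered. *)
Lemma isometric_metabolic_stable A :
  isometric (dsum_mx (block_mx 0 A A (0 : 'M_ _)) (sbform_opp A))
            (dsum_mx (block_mx 0 A A (A : 'M_ _)) (sbform_opp A)).
Proof.
apply: (@isometricE _ _ _ _ _
  (block_mx (block_mx 1%:M 0 0 1%:M) (col_mx 0 1%:M) (row_mx 1%:M 0) 1%:M)
  (block_mx (block_mx 1%:M 0 1%:M 1%:M) (col_mx 0 (- 1%:M))
            (row_mx (- 1%:M) 0) 1%:M)).
- rewrite mulmx_block !mulmx_block !mul_col_row !mul_row_block !mul_block_col.
  rewrite !mul_row_col !(mul0mx, mulmx0, mul1mx, mulmx1, add0r, addr0).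
  rewrite ?(mulmxN, mulNmx, mul1mx, mulmx1) !add_block_mx add_row_mx add_col_mx.
  rewrite !(addr0, add0r, addrN, addNr, subrr, oppr0) ?row_mx0 ?col_mx0.
  by rewrite -!scalar_mx_block.
- rewrite mulmx_block !mulmx_block !mul_col_row !mul_row_block !mul_block_col.
  rewrite !mul_row_col !(mul0mx, mulmx0, mul1mx, mulmx1, add0r, addr0).
  rewrite ?(mulmxN, mulNmx, mul1mx, mulmx1) !add_block_mx add_row_mx add_col_mx.
  rewrite !(addr0, add0r, addrN, addNr, subrr, oppr0) ?row_mx0 ?col_mx0.
  by rewrite -!scalar_mx_block.
rewrite !tr_block_mx tr_row_mx tr_col_mx !(trmx0, trmx1) /dsum_mx.
rewrite !mulmx_block !mul_row_block !(mul0mx, mulmx0, add0r, addr0) !mul_col_mx.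
rewrite !(mul0mx, mulmx0, mul1mx, mulmx1, add0r, addr0).
rewrite !mul_row_block !mul_row_col !mul_mx_row.
rewrite !(mul0mx, mulmx0, mul1mx, mulmx1, add0r, addr0).
rewrite !add_col_mx !add_row_mx /= !(addrN, add0r, addr0).
by rewrite row_mx0 col_mx0 -block_mxEv.
Qed.

Lemma GW_sum_opp A : GW_class A + GW_class (sbform_opp A) =
  GW_class (metabolic (@trmx0 k (sbf_dim A) (sbf_dim A))).
Proof.
apply: (addIr (GW_class (sbform_opp A))); rewrite -!GW_classD; apply/esym.
apply/GW_class_iso/(isometric_trans (isometric_metabolic_stable A)).
apply: isometric_dsum; last exact: isometric_refl.
exact/isometric_sym/isometric_sum_opp.
Qed.

Lemma GW_metabolic_id A :
  GW_class (metabolic (@trmx0 k (sbf_dim A) (sbf_dim A))) =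
  GW_class (@metabolic (sbform_id k (sbf_dim A)) _ (trmx0 _ _ _)).
Proof.
apply: GW_class_iso; have uA := sbf_unit A; apply: (@isometricE _ _ _ _ _
  (block_mx (A : 'M_ _) 0 0 1%:M) (block_mx (invmx A) 0 0 1%:M)).
- rewrite mulmx_block !(mul0mx, mulmx0, mul1mx, mulmx1, add0r, addr0).
  by rewrite mulmxV // -scalar_mx_block.
- rewrite mulmx_block !(mul0mx, mulmx0, mul1mx, mulmx1, add0r, addr0).
  by rewrite mulVmx // -scalar_mx_block.
rewrite tr_block_mx !trmx0 !trmx1 !mulmx_block sbf_sym.
by rewrite !(mul0mx, mulmx0, mul1mx, mulmx1, add0r, addr0).
Qed.

(** The product is the class of [A] plus that of [-A], hence that of the metabolic form with zero
    block. A change of basis in its first half replaces [A] by the identity, so only the dimension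
    survives. *)
Lemma GW_mul_hyperbolic A :
  GW_class A * (1 + <<N1_neq0>>) = (1 + <<N1_neq0>>) *+ sbf_dim A.
Proof.
have sumE B : GW_class B + GW_class (sbform_opp B) = GW_class B * (1 + <<N1_neq0>>).
  by rewrite GW_sbform_opp; ring.
rewrite -sumE GW_sum_opp GW_metabolic_id.
rewrite -(GW_sum_opp (sbform_id k (sbf_dim A))) sumE GW_class_id.
by rewrite mulr_natl.
Qed.

(** The orthogonal complement of the rows of [U] is the kernel of [A *m U^T]; nondegeneracy on [U]
    makes the sum direct and fixes the dimension. *)
Lemma isometric_split r A (U : 'M[k]_(r, sbf_dim A)) :
  U *m A *m U^T \in unitmx ->
  exists B, isometric A (dsum_mx (U *m A *m U^T) B) /\
    sbf_dim A = (r + sbf_dim B)%N.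
Proof.
move=> uD; set D := U *m A *m U^T in uD *.
have [K [KAU rfK]] : exists K : 'M_(\rank (kermx (A *m U^T)), sbf_dim A),
    K *m A *m U^T = 0 /\ row_free K.
  exists (row_base (kermx (A *m U^T))); rewrite row_base_free -mulmxA.
  by split=> //; apply/sub_kermxP; rewrite eq_row_base.
have UAK : U *m A *m K^T = 0.
  by apply: trmx_inj; rewrite trmx0 -[RHS]KAU !trmx_mul trmxK sbf_sym mulmxA.
pose P := col_mx U K.
have PAP : P *m A *m P^T = dsum_mx D (K *m A *m K^T).
  by rewrite /P tr_col_mx mul_col_mx mul_col_row KAU UAK.
have rfP : row_free P.
  rewrite -kermx_eq0; apply/rowV0P=> v /sub_kermxP.
  rewrite -[v]hsubmxK mul_row_col => E.
  have vD : lsubmx v *m D = (lsubmx v *m U + rsubmx v *m K) *m A *m U^T.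
    by rewrite !mulmxDl -!(mulmxA (rsubmx v)) KAU mulmx0 addr0 /D !mulmxA.
  have u0 : lsubmx v = 0 by rewrite -(mulmxK uD (lsubmx v)) vD E !mul0mx.
  move: E; rewrite u0 mul0mx add0r => E.
  have : rsubmx v *m K == 0 by apply/eqP.
  by rewrite mulmx_free_eq0 // => /eqP->; rewrite row_mx0.
have rk : \rank (A *m U^T) = r.
  apply/eqP; rewrite eqn_leq rank_leq_col /=.
  have : (\rank D <= \rank (A *m U^T))%N by rewrite /D -mulmxA mxrankM_maxr.
  by rewrite mxrank_unit.
have dimE : sbf_dim A = (r + \rank (kermx (A *m U^T)))%N.
  by have := rank_leq_row (A *m U^T); rewrite mxrank_ker rk => /subnKC.
have i : isometric (dsum_mx D (K *m A *m K^T)) A.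
  by exists P; split=> //; apply/eqP; rewrite [RHS]dimE; apply/eqP.
have sB : (K *m A *m K^T)^T = K *m A *m K^T.
  by rewrite !trmx_mul trmxK sbf_sym mulmxA.
have uB : K *m A *m K^T \in unitmx.
  have := isometric_unitmx i (sbf_unit A).
  by rewrite unitmxE det_ublock unitrM -!unitmxE => /andP[].
by exists (SBForm sB uB); split; first exact: isometric_sym.
Qed.

(* An alternating form, which has no vector of nonzero length, contains a     *)
(* hyperbolic plane, whose class is also a sum of rank one forms.             *)
Lemma GW_class_ind (P : GW k -> Prop) :
  P 0 -> (forall x y, P x -> P y -> P (x + y)) ->
  (forall (a : k) (a0 : a != 0), P <<a0>>) -> forall A, P (GW_class A).
Proof.
move=> P0 PD P1 A.
have [n] := ubnP (sbf_dim A); elim: n A => // n IHn A; rewrite ltnS => leAn.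
have [|] := pselect (exists v : 'rV_(sbf_dim A), v *m A *m v^T != 0).
  case=> v v0; have a0 : (v *m A *m v^T) 0 0 != 0.
    by apply: contra v0 => /eqP E; apply/eqP/matrixP=> i j; rewrite !ord1 E mxE.
  have E : v *m A *m v^T = ((v *m A *m v^T) 0 0)%:M by apply: mx11_scalar.
  have [|B [i dimA]] := @isometric_split 1 A v.
    by rewrite E; apply: rank_one_unit.
  rewrite E in i.
  rewrite (@GW_class_iso A (sbform_add (rank_one a0) B)) // GW_classD.
  by apply: PD => //; apply/IHn/(leq_trans _ leAn); rewrite dimA.
move=> A0; have [dim0|dimA] := posnP (sbf_dim A); first by rewrite GW_class_dim0.
have alt (v : 'rV_(sbf_dim A)) : v *m A *m v^T = 0.
  by apply/eqP/negPn/negP=> v0; apply: A0; exists v.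
have [v [w wAv]] : exists v w : 'rV[k]_(sbf_dim A), w *m A *m v^T = 1%:M.
  pose v : 'rV[k]_(sbf_dim A) := delta_mx 0 (Ordinal dimA).
  (* With this [w] the pairing becomes [v *m v^T], which is 1 for a basis vector. *)
  exists v, (v *m invmx A); rewrite mulmxKV ?sbf_unit // trmx_delta mul_delta_mx.
  by apply/matrixP=> i j; rewrite !ord1 !mxE.
have vAw : v *m A *m w^T = 1%:M.
  by apply: trmx_inj; rewrite trmx1 -wAv !trmx_mul trmxK sbf_sym mulmxA.
pose H := @metabolic (sbform_id k 1) _ (trmx0 k 1 1).
have E : col_mx v w *m A *m (col_mx v w)^T = H.
  by rewrite tr_col_mx mul_col_mx mul_col_row !alt wAv vAw.
have [|B [i dimAB]] := @isometric_split _ A (col_mx v w).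
  by rewrite E; exact: (sbf_unit H).
rewrite E in i.
rewrite (@GW_class_iso A (sbform_add H B)) // GW_classD.
apply: (PD); last by apply/IHn/(leq_trans _ leAn); rewrite dimAB.
rewrite -(GW_sum_opp (sbform_id k 1)) GW_class1 GW_sbform_opp GW_class1 mulr1.
by rewrite -(rank_one1 (oner_neq0 k)); apply: PD.
Qed.


End GrothendieckWitt.

(** * The trace form morphism *)

Section GaloisDescent.
Variables (k : fieldType) (L : splittingFieldType k) (galL : galois 1 {:L}).
Local Notation G := (gal_of {:L}).

Lemma gal_invariant (y : L) : (forall a : G, a y = y) -> exists c : k, y = c%:A.
Proof.
move=> inv; have : y \in fixedField 'Gal({:L} / 1)%g.
  by apply/fixedFieldP => [|a _]; rewrite ?memvf ?inv.
by move/galois_fixedField: galL => -> /vlineP.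
Qed.

Lemma in_alg_mx_inj m n : injective (map_mx (in_alg L) : 'M[k]_(m, n) -> 'M[L]_(m, n)).
Proof.
move=> A B /matrixP E; apply/matrixP=> i j; move: (E i j); rewrite !mxE.
exact: fmorph_inj.
Qed.

(* [descends to A]: A is the form (f, g) |-> \sum_x f x * g x on the k-space  *)
(* of equivariant functions f : T -> L, written in a basis F of that space.   *)
Definition descends (T : finType) (to : {action G &-> T}) (A : sbform k) :=
  sbf_dim A = #|T| /\ exists F : 'I_(sbf_dim A) -> T -> L,
    (forall i x (a : G), a (F i x) = F i (to x a)) /\
    (forall i j, ((A : 'M_ _) i j)%:A = \sum_x F i x * F j x).

Implicit Types (T U : finType).

(** Cross pairings of [F] and [F'] are Galois invariant, hence lie in [k], and they yield the change
    of basis. Independence of the families comes from the nondegeneracy of [A] and [B]. *)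
Lemma descends_unique T (to : {action G &-> T}) (A B : sbform k) :
  descends to A -> descends to B -> isometric A B.
Proof.
case: A B => m A sA uA [n B sB uB].
case=> /= mT [F [FE AE]] [/= nT [F' [FE' BE]]]; subst m n.
have /choice[c cE] (ij : 'I_#|T| * 'I_#|T|) :
    exists c : k, \sum_x F ij.1 x * F' ij.2 x = c%:A.
  apply: gal_invariant => a; rewrite rmorph_sum [RHS](reindex_inj (act_inj to a)).
  by apply: eq_bigr => x _; rewrite rmorphM /= FE FE'.
pose C : 'M[k]_#|T| := \matrix_(i, j) c (i, j).
pose M : 'M[L]_#|T| := \matrix_(i, j) F i (enum_val j).
pose N : 'M[L]_#|T| := \matrix_(i, j) F' i (enum_val j).
have sumE (f : T -> L) : \sum_x f x = \sum_(j < #|T|) f (enum_val j).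
  by rewrite (reindex (@enum_val _ T)) //; apply: onW_bij; apply: enum_val_bij.
have MM : M *m M^T = map_mx (in_alg L) A.
  apply/matrixP=> i j; rewrite !mxE /= AE sumE.
  by apply: eq_bigr => x _; rewrite !mxE.
have NN : N *m N^T = map_mx (in_alg L) B.
  apply/matrixP=> i j; rewrite !mxE /= BE sumE.
  by apply: eq_bigr => x _; rewrite !mxE.
have MN : M *m N^T = map_mx (in_alg L) C.
  apply/matrixP=> i j; rewrite !mxE /= -cE /= sumE.
  by apply: eq_bigr => x _; rewrite !mxE.
(* Over [L] this is [M] times the inverse of [N], because [C] is [M *m N^T] and [B] is
   [N *m N^T]. *)
pose P := C *m invmx B.
have PBP : P *m B *m P^T = A.
  rewrite mulmxKV //; apply: in_alg_mx_inj.
  rewrite -MM trmx_mul trmx_inv sB map_mxM map_mxM -map_trmx -MN map_invmx -NN.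
  rewrite trmx_mul trmxK !mulmxA.
  have uN : N *m N^T \in unitmx by rewrite NN map_unitmx.
  have : N *m (N^T *m invmx (N *m N^T)) = 1%:M by rewrite mulmxA mulmxV.
  move/mulmx1C; rewrite -!mulmxA => E.
  by rewrite (mulmxA (invmx _)) (mulmxA N^T) E mul1mx.
have uP : P \in unitmx.
  by move: uA; rewrite -PBP !unitmx_mul => /andP[/andP[]].
by exists P; rewrite row_free_unit row_full_unit.
Qed.

Lemma descends_iso T U (to : {action G &-> T}) (to' : {action G &-> U}) A :
  act_iso to to' -> descends to A -> descends to' A.
Proof.
case=> f [g fK gK] fE [dimA [F [FE AE]]]; split.
  by rewrite dimA; apply: (@bij_eq_card _ _ f); exists g.
exists (fun i y => F i (g y)); split=> [i y a|i j].
  by rewrite FE; congr (F i _); apply: (can_inj fK); rewrite fE !gK.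
rewrite AE (reindex f) /=; last by apply: onW_bij; exists g.
by apply: eq_bigr => x _; rewrite fK.
Qed.

Lemma descends_empty : descends (empty_act _) (sbform_id k 0).
Proof.
split; first by rewrite card_void.
by exists (fun i x => 0); split=> -[].
Qed.

Lemma descends_triv : descends (triv_act _) (sbform_id k 1).
Proof.
split; first by rewrite card_unit.
exists (fun i x => 1); split=> [i x a|i j]; first exact: rmorph1.
by rewrite !ord1 mxE big_const card_unit /= mulr1 addr0 scale1r.
Qed.

Lemma descends_sum T U (to : {action G &-> T}) (to' : {action G &-> U}) A B :
  descends to A -> descends to' B -> descends (sum_act to to') (sbform_add A B).
Proof.
case=> dimA [F [FE AE]] [dimB [F' [FE' BE]]]; split.
  by rewrite card_sum /= dimA dimB.
exists (fun i x => match split i, x with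
  | inl i, inl x => F i x | inr i, inr x => F' i x | _, _ => 0 end).
split=> [i [] x a|i j] /=; [case: (split i) => i' | case: (split i) => i' |].
- exact: FE.
- exact: rmorph0.
- exact: rmorph0.
- exact: FE'.
rewrite /dsum_mx big_sumType /= !mxE.
case: (splitP i) => i' _; rewrite mxE; case: (splitP j) => j' _.
- rewrite AE [X in _ + X]big1 ?addr0 // => x _; exact: mul0r.
- rewrite mxE scale0r !big1 ?addr0 // => x _; [exact: mul0r|exact: mulr0].
- rewrite mxE scale0r !big1 ?addr0 // => x _; [exact: mulr0|exact: mul0r].
by rewrite BE [X in X + _]big1 ?add0r // => x _; exact: mul0r.
Qed.

Lemma descends_prod T U (to : {action G &-> T}) (to' : {action G &-> U}) A B :
  descends to A -> descends to' B -> descends (prod_act to to') (sbform_mul A B).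
Proof.
case=> dimA [F [FE AE]] [dimB [F' [FE' BE]]]; split.
  by rewrite card_prod /= dimA dimB.
exists (fun i x => F (mxtens_unindex i).1 x.1 * F' (mxtens_unindex i).2 x.2).
split=> [i [x y] a|i j]; first by rewrite rmorphM /= FE FE'.
case: (mxtens_indexP i) => a b; case: (mxtens_indexP j) => c d.
rewrite tensmxE !mxtens_indexK /=.
transitivity ((A a c)%:A * (B b d)%:A : L); first by rewrite mulr_algl scalerA.
rewrite [RHS](eq_bigr (fun x => (F a x.1 * F c x.1) * (F' b x.2 * F' d x.2)));
  last by move=> x _; ring.
rewrite -(pair_bigA _ (fun x y => (F a x * F c x) * (F' b y * F' d y))) /=.
rewrite AE BE mulr_suml.
by apply: eq_bigr => x _; rewrite mulr_sumr.
Qed.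

(** A basis vector of $L^H$ gives the function sending the coset $Hg$ to its image under $g$, well
    defined because [H] fixes it. Summing over cosets is the trace ([ext_traceE]). *)
Lemma descends_orbit (H : {group G}) :
  descends (orbit_act H) (trace_form galL H).
Proof.
split; first by rewrite (card_coset_space galL).
set e := vbasis (fixedField H).
have eE i : e`_i \in fixedField H.
  have [lt_in|ge_in] := ltnP i (\dim (fixedField H)).
    by apply: vbasis_mem; rewrite mem_nth ?size_tuple.
  by rewrite nth_default ?mem0v ?size_tuple.
have eH i h : h \in H -> h e`_i = e`_i by case/mem_fixedFieldP: (eE i) => _; apply.
exists (fun i (C : coset_space H) => (fingroup.repr (val C) : G) e`_i); split=> [i [C CP] a|i j] /=.
  case/rcosetsP: CP => g _ ->; rewrite -rcosetM.
  case: repr_rcosetP => x xH; case: repr_rcosetP => y yH.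
  by rewrite !galM ?memvf // (eH i x) // (eH i y).
rewrite [trace_form_mx H i j]mxE (ext_traceE galL) ?rpredM ?eE // [RHS](reindex (fun j =>
  enum_val (cast_ord (esym (card_coset_space galL H)) j))) /=.
  by apply: eq_bigr => l _; rewrite rmorphM.
apply: onW_bij; apply: bij_comp (enum_val_bij _) _.
by exists (cast_ord (card_coset_space galL H)) => l; rewrite ?cast_ordK ?cast_ordKV.
Qed.

Lemma descends_exists T (to : {action G &-> T}) : exists A, descends to A.
Proof.
elim/act_ind: T / to => [T U to to' i [A dA]||H T to [A dA]].
- by exists A; apply: descends_iso i dA.
- by exists (sbform_id k 0); apply: descends_empty.
by eexists; apply: descends_sum (descends_orbit H) dA.
Qed.

Lemma trace_form_morphism :
  exists h : {rmorphism burnside G -> GW k},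
    forall T (to : {action G &-> T}) A,
      descends to A -> h (burnside_class to) = GW_class A.
Proof.
have /choice[f fP] (X : gset_rig G) : exists A, descends (gset_act X) A.
  exact: descends_exists.
pose g X := GW_class (f X).
have gE (X : gset_rig G) A : descends (gset_act X) A -> g X = GW_class A.
  by move=> dA; apply/GW_class_iso/(descends_unique (fP X) dA).
have [X Y XY|X Y|X Y||h hE] := @groth_ring_lift (gset_rig G) (GW k) g.
- by apply/gE/descends_iso/fP/act_iso_sym.
- rewrite /g -GW_classD; apply: gE.
  exact: descends_iso (act_iso_sym (gset_ofP _)) (descends_sum (fP X) (fP Y)).
- rewrite /g -GW_classM; apply: gE.
  exact: descends_iso (act_iso_sym (gset_ofP _)) (descends_prod (fP X) (fP Y)).
- apply: gE; exact: descends_iso (act_iso_sym (gset_ofP _)) descends_triv.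
exists h => T to A dA; rewrite [LHS]hE; apply: gE.
exact: descends_iso (act_iso_sym (gset_ofP _)) dA.
Qed.

Lemma burnside_morphism_eq (V : zmodType) (h h' : {additive burnside G -> V}) :
  (forall H : {group G},
     h (burnside_class (orbit_act H)) = h' (burnside_class (orbit_act H))) ->
  h =1 h'.
Proof.
move=> E; elim/burnside_ind => T to U to'.
suff E' (S : finType) (a : {action G &-> S}) : h (burnside_class a) = h' (burnside_class a).
  by rewrite !raddfB !E'.
elim/act_ind: S / a => [S S' a b i||H S a IH].
- by rewrite (burnside_class_iso i).
- by rewrite burnside_class0 !raddf0.
by rewrite burnside_classD !raddfD IH E.
Qed.

End GaloisDescent.

Local Notation reg gT := (burnside_class (mulgr_action gT)).
Local Notation "<< a0 >>" := (GW_class (rank_one a0)).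

(** * Burnside rings of groups of order at most two *)

Section SmallGroups.
Variable gT : finGroupType.
Hypothesis gT2 : (#|gT| %| 2)%N.

(** The only subgroups are the trivial one and the whole group, whose orbits are $[G]$ and $1$. *)
Lemma burnside_span z : exists m n : int, z = m%:~R + reg gT *~ n.
Proof.
have spanD (z1 z2 : burnside gT) : (exists m n : int, z1 = m%:~R + reg gT *~ n) ->
    (exists m n : int, z2 = m%:~R + reg gT *~ n) ->
    exists m n : int, z1 + z2 = m%:~R + reg gT *~ n.
  case=> m [n ->] [m' [n' ->]]; exists (m + m'), (n + n').
  by rewrite !mulrzDr addrACA.
have spanN (z1 : burnside gT) : (exists m n : int, z1 = m%:~R + reg gT *~ n) ->
    exists m n : int, - z1 = m%:~R + reg gT *~ n.
  by case=> m [n ->]; exists (- m), (- n); rewrite !mulrNz opprD.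
elim/burnside_ind: z => T to U to'.
suff span (S : finType) (a : {action gT &-> S}) :
    exists m n : int, burnside_class a = m%:~R + reg gT *~ n.
  by apply/spanD/spanN/span/span.
elim/act_ind: S / a => [S S' a b i|| H S a IH].
- by rewrite (burnside_class_iso i).
- by exists 0, 0; rewrite burnside_class0 !mulr0z addr0.
rewrite burnside_classD; apply: spanD => //.
have [H1|H2] : H = 1%G \/ H = [set: gT]%G.
  have HG : (#|H| %| #|gT|)%N by rewrite -cardsT cardSg ?subsetT.
  have [/eqP|Hneq1] := boolP (#|H| == 1%N).
    by move/card1_trivg => H1; left; apply: val_inj.
  right; apply/val_inj/eqP; rewrite /= eqEcard subsetT cardsT /=.
  have := dvdn_leq (ltn0Sn 1) gT2; suff -> : #|H| = 2%N by [].
  have := dvdn_trans HG gT2; rewrite dvdn_divisors //.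
  by rewrite !inE (negPf Hneq1) => /eqP.
- by rewrite H1 (burnside_class_iso (orbit_act1_iso gT)); exists 0, 1; rewrite add0r.
rewrite H2 (burnside_class_iso (orbit_actT_iso gT)) burnside_class1.
by exists 1, 0; rewrite mulr0z addr0.
Qed.

End SmallGroups.

Lemma reg_trivial (gT : finGroupType) : #|gT| = 1%N -> reg gT = 1.
Proof.
move=> G1; rewrite -burnside_class1; apply: burnside_class_iso.
exists (fun _ => tt) => //; exists (fun _ => 1%g) => [a|[] //].
by apply: (fintype_le1P _); rewrite G1.
Qed.

Lemma orbits_reg (gT : finGroupType) : #|orbits (mulgr_action gT)| = 1%N.
Proof.
suff -> : orbits (mulgr_action gT) = [set [set: gT]] by rewrite cards1.
have E (a : gT) : orbit (mulgr_action gT) [set: gT] a = [set: gT].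
  apply/setP=> b; rewrite inE; apply/orbitP; exists (a^-1 * b)%g; rewrite ?inE //.
  by rewrite /= mulKVg.
apply/setP=> O; rewrite inE; apply/imsetP/eqP => [[a _ ->]|->]; first exact: E.
by exists 1%g; rewrite ?inE ?E.
Qed.

Lemma orbits_triv (gT : finGroupType) : #|orbits (triv_act gT)| = 1%N.
Proof.
suff -> : orbits (triv_act gT) = [set [set tt]] by rewrite cards1.
have E : orbit (triv_act gT) [set: gT] tt = [set tt].
  apply/setP=> -[]; rewrite inE eqxx; apply/orbitP; by exists 1%g; rewrite ?inE.
apply/setP=> O; rewrite inE; apply/imsetP/eqP => [[[] _ ->]|->]; first exact: E.
by exists tt; rewrite ?inE ?E.
Qed.

(** * Sums of squares and inertia *)

Section Fields.
Variable k : fieldType.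

Definition sum_of_squares (x : k) := exists s : seq k, x = \sum_(y <- s) y ^+ 2.

Lemma sum_of_squares_fin (I : finType) (f : I -> k) :
  sum_of_squares (\sum_i f i ^+ 2).
Proof. by exists [seq f i | i <- index_enum I]; rewrite big_map. Qed.

Lemma sum_of_squaresD x y :
  sum_of_squares x -> sum_of_squares y -> sum_of_squares (x + y).
Proof. by case=> s -> [t ->]; exists (s ++ t); rewrite big_cat. Qed.

Lemma sum_of_squaresM x y : sum_of_squares x -> sum_of_squares (y ^+ 2 * x).
Proof.
case=> s ->; exists [seq y * z | z <- s]; rewrite big_map mulr_sumr.
by apply: eq_bigr => z _; rewrite exprMn.
Qed.

Lemma formally_real_eq0 x y : ~ sum_of_squares (-1) ->
  sum_of_squares y -> x ^+ 2 + y = 0 -> x = 0.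
Proof.
move=> real sy E; apply: contra_notP real => /eqP x0.
have -> : -1 = x^-1 ^+ 2 * y.
  move/eqP: E; rewrite addrC addr_eq0 => /eqP->.
  by rewrite mulrN -exprMn mulVf // expr1n.
exact: sum_of_squaresM.
Qed.

Lemma formally_real_neq2 : ~ sum_of_squares (-1) -> 2%:R != 0 :> k.
Proof.
move=> real; apply/eqP => E; apply: real; exists [:: 1]; rewrite big_seq1 expr1n.
by apply/eqP; rewrite eq_sym -addr_eq0 -E.
Qed.

(* Inertia: a vector of the positive part whose image has no positive         *)
(* component would be isotropic for a sum of squares.                         *)
Lemma inertia p q r s : ~ sum_of_squares (-1) ->
  isometric (dsum_mx (1%:M : 'M[k]_p) (- 1%:M : 'M_q))
            (dsum_mx (1%:M : 'M_r) (- 1%:M : 'M_s)) -> (p <= r)%N.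
Proof.
move=> real [P [_ _]]; rewrite -[P]submxK /dsum_mx tr_block_mx !mulmx_block.
set X := ulsubmx P; set Y := ursubmx P.
rewrite !(mulmx0, addr0, add0r, mulmx1, mulmxN, mulNmx) => /eq_block_mx[E _ _ _].
rewrite leqNgt; apply/negP => ltrp.
have : kermx X != 0.
  by rewrite -mxrank_eq0 mxrank_ker -lt0n subn_gt0 (leq_ltn_trans (rank_leq_col _)).
case/rowV0Pn=> u /sub_kermxP uX; case/negP; apply/eqP.
have sqE n (w : 'rV[k]_n) : (w *m w^T) 0 0 = \sum_i w 0 i ^+ 2.
  by rewrite mxE; apply: eq_bigr => i _; rewrite mxE expr2.
have : u *m u^T + (u *m Y) *m (u *m Y)^T = 0.
  rewrite -{1}[u]mulmx1 -E mulmxDr mulmxN !mulmxA uX mul0mx add0r.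
  by rewrite trmx_mul mulNmx !mulmxA addNr.
move/matrixP/(_ 0 0); rewrite [in LHS]mxE !sqE [RHS]mxE => sum0.
apply/rowP=> j; rewrite [RHS]mxE.
apply: (formally_real_eq0 real (y := \sum_(i | i != j) u 0 i ^+ 2 +
  \sum_i (u *m Y) 0 i ^+ 2)).
  apply: sum_of_squaresD; last exact: sum_of_squares_fin.
  by exists [seq u 0 i | i <- index_enum _ & i != j]; rewrite big_map big_filter.
by rewrite addrA -[RHS]sum0 [in RHS](bigD1 j).
Qed.

(** Halving is possible: in the hyperbolic form on the right, the rows $(A/2, 1)$ have Gram matrix
    [A]. *)
Lemma isometric_metabolic (A : sbform k) : 2%:R != 0 :> k ->
  isometric (block_mx 0 A A (A : 'M_ _))
    (block_mx 0 (1%:M : 'M[k]_(sbf_dim A)) (1%:M : 'M_(sbf_dim A)) 0).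
Proof.
move=> two; pose c : k := 2%:R^-1; have uA := sbf_unit A.
have cc : c + c = 1 by rewrite -mulr2n -[c *+ 2]mulr_natr mulVf.
apply: (@isometricE _ _ _ _ _
  (block_mx A 0 (c *: (A : 'M_ _)) 1%:M) (block_mx (invmx A) 0 (- c%:M) 1%:M)).
- rewrite mulmx_block !(mul0mx, mulmx0, mul1mx, mulmx1, add0r, addr0).
  by rewrite -scalemxAl mulmxV // scalemx1 addrN -scalar_mx_block.
- rewrite mulmx_block !(mul0mx, mulmx0, mul1mx, mulmx1, add0r, addr0).
  by rewrite mulVmx // mulNmx mul_scalar_mx addNr -scalar_mx_block.
rewrite tr_block_mx !trmx0 !trmx1 linearZ /= !mulmx_block sbf_sym.
rewrite !(mul0mx, mulmx0, mul1mx, mulmx1, add0r, addr0).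
by rewrite -scalerDl cc scale1r.
Qed.

Lemma isometric_opp_id (A : sbform k) : 2%:R != 0 :> k ->
  isometric (dsum_mx A (sbform_opp A))
    (dsum_mx (1%:M : 'M[k]_(sbf_dim A)) (- 1%:M : 'M_(sbf_dim A))).
Proof.
move=> two; apply: isometric_trans (isometric_sum_opp A) _.
apply: isometric_trans (isometric_metabolic A two) _; apply: isometric_sym.
apply: isometric_trans (isometric_sum_opp (sbform_id k (sbf_dim A))) _.
exact: isometric_metabolic (sbform_id k (sbf_dim A)) two.
Qed.

(** Equality in $GW(k)$ is isometry after adding some [E]. Adding [-E] as well replaces [E] by [d]
    copies each of $<1>$ and $<-1>$, where [d] is its dimension; inertia then gives [n + d <= d]. *)
Lemma GW_N1_torsion n : ~ sum_of_squares (-1) ->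
  << N1_neq0 k >> *+ n = n%:R -> n = 0%N.
Proof.
move=> real; rewrite -GW_class_id -mulr_natr -GW_class_id -GW_sbform_opp.
case/GW_class_eqP=> E /= i; have two := formally_real_neq2 real.
have {}i := isometric_dsum i (isometric_refl (sbform_opp E)).
have step m (B : 'M[k]_m) : isometric (dsum_mx (dsum_mx B E) (sbform_opp E))
    (dsum_mx B (dsum_mx (1%:M : 'M_(sbf_dim E)) (- 1%:M : 'M_(sbf_dim E)))).
  apply: isometric_trans (isometric_sym (isometric_dsumA _ _ _)) _.
  exact: isometric_dsum (isometric_refl _) (isometric_opp_id E two).
have {}i := isometric_trans (isometric_sym (step _ _))
  (isometric_trans (isometric_sym i) (step _ _)).
suff: (n + sbf_dim E <= sbf_dim E)%N by rewrite -{2}[sbf_dim E]add0n leq_add2r leqn0 => /eqP.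
apply: (inertia real (q := sbf_dim E) (s := (n + sbf_dim E)%N)).
have -> : (1%:M : 'M[k]_(n + sbf_dim E)) = dsum_mx 1%:M 1%:M.
  by rewrite [LHS]scalar_mx_block.
rewrite [- dsum_mx _ _]opp_block_mx !oppr0.
apply: isometric_trans (isometric_sym (isometric_dsumA _ _ _)) _.
apply: isometric_trans i _; apply: isometric_trans (isometric_dsumA _ _ _) _.
apply: isometric_trans (isometric_dsum (isometric_dsumC _ _) (isometric_refl _)) _.
exact: isometric_sym (isometric_dsumA _ _ _).
Qed.

(** The matrix of multiplication by $p + qi$ scales the form $x^2 + y^2$ by the norm $p^2 + q^2 =
    -1$. *)
Lemma GW_N1_sum2 (p q : k) : -1 = p ^+ 2 + q ^+ 2 -> << N1_neq0 k >> *+ 2 = 2%:R.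
Proof.
move=> E; rewrite mulr2n -!GW_classD [in RHS](_ : 2%:R = 1 + 1) // -GW_class1.
rewrite -GW_classD; apply: GW_class_iso => /=.
pose P := block_mx p%:M q%:M (- q)%:M p%:M : 'M[k]_(1 + 1).
have PP : P *m P^T = - 1%:M.
  rewrite tr_block_mx !tr_scalar_mx mulmx_block -!scalar_mxM -!raddfD /=.
  rewrite scalar_mx_block opp_block_mx oppr0 -raddfN /= E.
  by congr block_mx; rewrite -?(raddf0 (@scalar_mx k 1)); congr _%:M; ring.
have PN : P *m (- P^T) = 1%:M by rewrite mulmxN PP opprK.
apply: (isometricE PN (mulmx1C PN)).
rewrite /dsum_mx -scalar_mx_block mulmx1 PP.
by rewrite scalar_mx_block opp_block_mx !oppr0 -raddfN.
Qed.

(** If $x^2 + c^2 = -y^2$ with $y$ nonzero, dividing by $y^2$ writes $-1$ as a sum of two squares.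
    So every sum of squares is a square, and $-1$ is not one. *)
Lemma euclidean_criterion :
  (forall a : k, a != 0 -> exists2 y, y != 0 & a = y ^+ 2 \/ a = - y ^+ 2) ->
  (forall p q : k, -1 <> p ^+ 2 + q ^+ 2) -> euclidean_field k.
Proof.
move=> sq no2.
have sum_sq (s : seq k) : exists c : k, \sum_(x <- s) x ^+ 2 = c ^+ 2.
  elim: s => [|x s [c IH]]; first by exists 0; rewrite big_nil expr0n.
  rewrite big_cons IH; have [->|n0] := eqVneq (x ^+ 2 + c ^+ 2) 0.
    by exists 0; rewrite expr0n.
  have [y y0 [E|E]] := sq _ n0; first by exists y.
  case: (no2 (x / y) (c / y)).
  by rewrite !expr_div_n -mulrDl E mulNr mulfV // expf_neq0.
have noS : ~ sum_of_squares (-1).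
  by case=> s; have [c ->] := sum_sq s => E; apply: (no2 c 0); rewrite E expr0n addr0.
split=> //; exists (fun i : 'I_2 => (-1) ^+ i).
split=> [i|x x0]; first by rewrite expf_neq0 // N1_neq0.
have no1 (y y' : k) : y != 0 -> y ^+ 2 <> - y' ^+ 2.
  move=> y0 E; apply: (no2 (y' / y) 0).
  by rewrite expr_div_n expr0n addr0 -[y' ^+ 2]opprK -E mulNr mulfV // expf_neq0.
have [y y0 [E|E]] := sq x x0.
  exists 0; split; first by exists y; rewrite // mul1r.
  case=> -[|[|//]] lt2 [y' y'0 E'] //; first exact: val_inj.
  by case: (no1 y y' y0); rewrite -E E' mulN1r.
exists 1; split; first by exists y; rewrite // mulN1r.
case=> -[|[|//]] lt2 [y' y'0 E'] //; last exact: val_inj.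
by case: (no1 y' y y'0); rewrite -E E' mul1r.
Qed.

(** Since $-1$ is not a square, $1$ and $-1$ represent the two square classes. *)
Lemma euclidean_squares : euclidean_field k ->
  forall a : k, a != 0 -> exists2 y, y != 0 & a = y ^+ 2 \/ a = - y ^+ 2.
Proof.
case=> real [r [r0 rP]].
have no1 (y y' : k) : y != 0 -> y ^+ 2 <> - y' ^+ 2.
  move=> y0 E; apply: real; exists [:: y' / y].
  by rewrite big_seq1 expr_div_n -[y' ^+ 2]opprK -E mulNr mulfV // expf_neq0.
have [i [[y y0 E1] iU]] := rP 1 (oner_neq0 k).
have [j [[z z0 EN] jU]] := rP (-1) (N1_neq0 k).
have ij : i != j.
  apply/eqP=> ij; apply: (no1 z y z0).
  apply: (mulfI (r0 i)); rewrite mulrN -E1 ij -EN //.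
move=> a a0; have [l [[w w0 Ea] _]] := rP a a0.
have [li|lj] : l = i \/ l = j.
  case: l i j ij {Ea E1 EN iU jU} => -[|[|//]] ? [[|[|//]] ?] [[|[|//]] ?] //= _;
    by [left; apply: val_inj | right; apply: val_inj].
- exists (w / y); first by rewrite mulf_neq0 ?invr_eq0.
  left; rewrite expr_div_n; apply: (mulIf (expf_neq0 2 y0)).
  rewrite mulfVK ?expf_neq0 // Ea li; rewrite mulrAC -E1 mul1r //.
exists (w / z); first by rewrite mulf_neq0 ?invr_eq0.
right; rewrite expr_div_n; apply: (mulIf (expf_neq0 2 z0)).
by rewrite mulNr mulfVK ?expf_neq0 // Ea lj mulrAC -EN mulN1r.
Qed.

End Fields.

Lemma order2_elements (gT : finGroupType) : #|gT| = 2%N ->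
  exists2 s : gT, s != 1%g & forall g : gT, g = 1%g \/ g = s.
Proof.
move=> G2; have /eqP/cards1P[s sE] : #|[set: gT] :\ 1%g| = 1%N.
  by have := cardsD1 1%g [set: gT]; rewrite cardsT G2 inE add1n => -[].
exists s => [|g]; first by have /setD1P[] : s \in [set: gT] :\ 1%g by rewrite sE set11.
have [->|g1] := eqVneq g 1%g; [by left | right].
by apply/set1P; rewrite -sE !inE g1.
Qed.

Lemma inj_surj_bij (A B : Type) (f : A -> B) :
  injective f -> (forall b, exists a, f a = b) -> bijective f.
Proof.
move=> fI /choice[g gK]; exists g; last exact: gK.
by move=> a; apply: fI; rewrite gK.
Qed.

(** * When the trace form morphism is bijective *)

Section TraceFormMorphism.
Variables (k : fieldType) (L : splittingFieldType k) (galL : galois 1 {:L}).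
Local Notation G := (gal_of {:L}).
Local Notation x := (reg G).
Local Notation e := (<< N1_neq0 k >>).

Variable h : {rmorphism burnside G -> GW k}.
Hypothesis hE : forall (T : finType) (to : {action G &-> T}) A,
  descends to A -> h (burnside_class to) = GW_class A.
Local Notation card := (@burnside_card G).
Local Notation orb := (@burnside_orbits G).
Local Notation rank := (@GW_rank k).

Lemma card_gal : #|{: G}| = \dim {:L}.
Proof. by rewrite -[LHS]cardsT -(gal1T L) -(galois_dim galL) dimv1 divn1. Qed.

Lemma rank_h z : rank (h z) = card z.
Proof.
elim/burnside_ind: z => T to U to'; rewrite !raddfB /=.
suff E (S : finType) (a : {action G &-> S}) :
    rank (h (burnside_class a)) = card (burnside_class a) by rewrite !E.
have [A dA] := descends_exists galL a.
by rewrite (hE dA) GW_rankE burnside_cardE (proj1 dA).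
Qed.

Lemma mul_hyperbolic (w : GW k) : w * (1 + e) = (1 + e) *~ rank w.
Proof.
elim/GW_ind: w => A B.
by rewrite mulrBl !GW_mul_hyperbolic raddfB /= !GW_rankE mulrzBr.
Qed.

Lemma rank1 : rank 1 = 1. Proof. by rewrite -GW_class1 GW_rankE. Qed.
Lemma card1 : card 1 = 1. Proof. by rewrite -burnside_class1 burnside_cardE card_unit. Qed.
Lemma orb1 : orb 1 = 1. Proof. by rewrite -burnside_class1 burnside_orbitsE orbits_triv. Qed.
Lemma card_reg : card x = #|{: G}|%:Z. Proof. exact: burnside_cardE. Qed.
Lemma orb_reg : orb x = 1. Proof. by rewrite burnside_orbitsE orbits_reg. Qed.

Lemma orb_span m n : orb (m%:~R + x *~ n) = m + n.
Proof. by rewrite raddfD !raddfMz /= orb1 orb_reg !intz. Qed.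

Lemma card_span m n : card (m%:~R + x *~ n) = m + #|{: G}|%:Z * n.
Proof. by rewrite raddfD !raddfMz /= card1 card_reg intz -mulrzr intz. Qed.

(* With h y the hyperbolic plane, #|G| * y = x * y = 2 * x; counting orbits,  *)
(* #|G| divides 2.                                                            *)
Lemma card_gal_dvd2 y : injective h -> h y = 1 + e -> (#|{: G}| %| 2)%N.
Proof.
move=> hI hy.
have xy : x * y = y *+ #|{: G}|.
  apply: hI; rewrite rmorphM rmorphMn /= hy mul_hyperbolic rank_h card_reg.
  by rewrite pmulrn.
have cy : card y = 2 by rewrite -rank_h hy raddfD /= rank1 GW_rankE.
have := congr1 orb xy; rewrite mulrC mul_reg cy raddfMz.
rewrite [orb (y *+ _)]raddfMn /= orb_reg -[orb y *+ _]mulr_natr [X in _ * X]natz.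
by move/(congr1 absz); rewrite abszM => E; apply/dvdnP; exists `|orb y|%N.
Qed.

(** Here $A(G)$ consists of the integers, so $<a>$ is an integer of rank 1, namely $<1>$;
    discriminants finish. *)
Lemma h_iso_trivial : #|{: G}| = 1%N -> injective h -> (forall w, exists z, h z = w) ->
  quadratically_closed k.
Proof.
move=> G1 hI hS a; have [->|a0] := eqVneq a 0; first by exists 0; rewrite expr0n.
have [z hz] := hS << a0 >>.
have [|m [n zE]] := burnside_span _ z; first by rewrite G1.
have {}zE : z = (m + n)%:~R by rewrite zE (reg_trivial G1) mulrzDr.
have := rank_h z; rewrite hz GW_rankE /= zE raddfMz /= card1 => mn.
have {mn} : m + n = 1 by move: mn; rewrite -mulrzr mul1r intz.
move=> mn; move: hz; rewrite zE mn rmorph1 -(rank_one1 (oner_neq0 k)).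
move=> /esym/rank_one_inj[y _ ->]; exists y; by rewrite mul1r.
Qed.

(** * Necessity for a group of order two *)

Section DegreeTwo.
Hypotheses (G2 : #|{: G}| = 2%N) (hI : injective h) (hS : forall w, exists z, h z = w).

(** Otherwise $2(1 + <-1>) = 4$, and multiplying $h[G]$ by it gives $4 h[G] = 8$. Injectivity yields
    $4[G] = 8$ in $A(G)$, but the orbit counts are 4 and 8. *)
Lemma N1_not_torsion : e *+ 2 <> 2%:R.
Proof.
move=> e2; have H2 : (1 + e) * 2%:R = 4%:R.
  by rewrite mulr_natr mulrnDl e2 -natrD.
have : x *+ 4 = 8%:R.
  apply: hI; rewrite rmorphMn rmorph_nat /= -mulr_natr -H2 mulrA mul_hyperbolic.
  by rewrite rank_h card_reg G2 -pmulrn -[(1 + e) *+ 2]mulr_natr H2 -natrM.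
by move/(congr1 orb); rewrite !raddfMn /= orb_reg orb1.
Qed.

Lemma N1_neq_sum2 (p q : k) : -1 <> p ^+ 2 + q ^+ 2.
Proof. by move/GW_N1_sum2/N1_not_torsion. Qed.

(** Write the preimage as $z = m + n[G]$. Cardinality gives $m + 2n = 1$; counting orbits in $z^2 =
    1$, with $z[G] = [G]$, gives $m(m + n) + n = 1$. Together they say $n(n - 1) = 0$. *)
Lemma rank_one_dichotomy (a : k) (a0 : a != 0) :
  << a0 >> = 1 \/ << a0 >> = h x - 1.
Proof.
have [z hz] := hS << a0 >>.
have [|m [n zE]] := burnside_span _ z; first by rewrite G2.
have cz : card z = 1 by rewrite -rank_h hz GW_rankE.
have zz : z * z = 1 by apply: hI; rewrite rmorphM hz rmorph1 rank_one_sqr.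
have : z *~ m + x *~ n = 1.
  rewrite -zz {3}zE mulrDr mulrzr mulrzAr; congr (_ + _ *~ n).
  by rewrite mul_reg cz.
move/(congr1 orb); rewrite raddfD !raddfMz /= orb1 orb_reg zE orb_span.
move: cz; rewrite zE card_span G2 -[_ *~ m]mulrzr !intz => cz oz.
have [[m1 n0]|[m1 n1]] : (m = 1 /\ n = 0) \/ (m = -1 /\ n = 1).
  have mE : m = 1 - 2 * n by move: cz; lia.
  have /eqP : n * (n - 1) = 0 by move: oz; rewrite mE; nia.
  by rewrite mulf_eq0 subr_eq0 => /orP[] /eqP n1; [left|right]; rewrite mE n1.
- by left; rewrite -hz zE m1 n0 mulr0z addr0 rmorph1.
by right; rewrite -hz zE m1 n1 rmorphD rmorphN rmorph1 mulr1z addrC.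
Qed.

(** Applied to $-1$, the dichotomy identifies $h[G] - 1$ with $<-1>$, as $<-1> = <1>$ would be
    torsion. Discriminants then turn equal classes into equal square classes. *)
Lemma square_dichotomy (a : k) :
  a != 0 -> exists2 y, y != 0 & a = y ^+ 2 \/ a = - y ^+ 2.
Proof.
have e1 : e <> 1.
  by move=> E; apply: N1_not_torsion; rewrite E.
have [//|eE] := rank_one_dichotomy (N1_neq0 k).
move=> a0; have [|] := rank_one_dichotomy a0.
  rewrite -(rank_one1 (oner_neq0 k)) => /rank_one_inj[y y0 ->].
  by exists y => //; left; rewrite mul1r.
rewrite -eE => /rank_one_inj[y y0 ->].
by exists y => //; right; rewrite mulN1r.
Qed.

(** An element [y] negated by the nontrivial automorphism has its square in [k] but is not itself in
    [k]. So the square is $-d^2$ rather than $d^2$, and $y/d$ is the required root. *)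
Lemma quadratic_i : exists2 i : L, i ^+ 2 = -1 & <<1; i>>%VS = {:L}%VS.
Proof.
have [s s1 sE] := order2_elements G2.
have [b sb] : exists b : L, s b != b.
  apply/not_existsP => fix_s; case/eqP: s1; apply/eqP/gal_eqP => b _.
  by rewrite gal_id; apply/eqP/negPn/negP/fix_s.
pose y := b - s b.
have ss : (s * s = 1)%g.
  case: (sE (s * s)%g) => // E.
  by case/eqP: s1; apply: (mulgI s); rewrite E mulg1.
have sy : s y = - y.
  by rewrite rmorphB /= -galM ?memvf // ss gal_id opprB.
have y0 : y != 0 by rewrite subr_eq0 eq_sym.
have [c yc] : exists c : k, y ^+ 2 = c%:A.
  apply: (gal_invariant galL) => g; case: (sE g) => ->; first by rewrite gal_id.
  by rewrite rmorphXn /= sy sqrrN.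
have c0 : c != 0.
  by apply: contra_neq y0 => c0; apply/eqP; rewrite -sqrf_eq0 yc c0 scale0r.
(* In characteristic two, $-1 = 1^2 + 0^2$. *)
have two : (1 + 1 : L) != 0.
  apply/eqP => two; apply: (N1_neq_sum2 (p := 1) (q := 0)); rewrite expr1n expr0n addr0.
  apply/eqP; rewrite eq_sym -addr_eq0 -(fmorph_eq0 (in_alg L)) rmorphD /= scale1r.
  exact/eqP.
have notk d : y != d%:A.
  apply/eqP => yd; have : y + y = 0.
    by rewrite -{1}[y]opprK -sy yd linearZ /= rmorph1 addNr.
  by move/eqP; rewrite -[y]mul1r -mulrDl mulf_eq0 (negPf two) (negPf y0).
have [d d0 [E|E]] := square_dichotomy c0.
  have : (y - d%:A) * (y + d%:A) == 0.
    by rewrite -subr_sqr yc E -[d%:A ^+ 2](rmorphXn (in_alg L)) subrr.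
  rewrite mulf_eq0 subr_eq0 (negPf (notk d)) addr_eq0 -scaleNr.
  by rewrite (negPf (notk _)).
exists (y / d%:A).
  rewrite expr_div_n yc E -[d%:A ^+ 2](rmorphXn (in_alg L)) /= scaleNr mulNr.
  by rewrite mulfV // (fmorph_eq0 (in_alg L)) expf_neq0.
set i := y / d%:A; apply/eqP; rewrite eqEdim subvf -card_gal G2.
rewrite ltnNge; apply/negP => dim1.
have : <<1; i>>%VS = 1%VS.
  by apply/esym/eqP; rewrite eqEdim dimv1 dim1 andbT subv_adjoin.
move=> E1; have : i \in 1%VS by rewrite -E1 memv_adjoin.
case/vlineP=> f iE; case/negP: (notk (f * d)).
rewrite -scalerA; apply/eqP; rewrite -[d%:A]mul1r scalerAl -iE.
by rewrite mulfVK // (fmorph_eq0 (in_alg L)).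
Qed.

End DegreeTwo.

Lemma GW_span (w : GW k) :
  (forall (a : k) (a0 : a != 0), << a0 >> = 1 \/ << a0 >> = e) ->
  exists m n : int, w = m%:~R + e *~ n.
Proof.
move=> gen.
have spanD w1 w2 : (exists m n : int, w1 = m%:~R + e *~ n) ->
    (exists m n : int, w2 = m%:~R + e *~ n) ->
    exists m n : int, w1 + w2 = m%:~R + e *~ n.
  case=> m [n ->] [m' [n' ->]]; exists (m + m'), (n + n').
  by rewrite !mulrzDr addrACA.
have spanN w1 : (exists m n : int, w1 = m%:~R + e *~ n) ->
    exists m n : int, - w1 = m%:~R + e *~ n.
  by case=> m [n ->]; exists (- m), (- n); rewrite !mulrNz opprD.
have span A : exists m n : int, GW_class A = m%:~R + e *~ n.
  move: A; apply: (@GW_class_ind _ (fun w => exists m n : int, w = m%:~R + e *~ n))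
    => [|//|a a0].
    by exists 0, 0; rewrite !mulr0z addr0.
  have [->|->] := gen a a0; first by exists 1, 0; rewrite mulr0z addr0.
  by exists 0, 1; rewrite mulr0z add0r.
by elim/GW_ind: w => A B; apply/spanD/spanN.
Qed.

Lemma h_bij_trivial : quadratically_closed k -> #|{: G}| = 1%N -> bijective h.
Proof.
move=> sq G1; apply: inj_surj_bij => [|w].
  apply: raddf_inj => z /=; have [|m [n ->]] := burnside_span _ z; first by rewrite G1.
  rewrite (reg_trivial G1) -mulrzDr rmorph_int => /(congr1 rank).
  by rewrite raddfMz raddf0 /= rank1 intz => ->.
have gen (a : k) (a0 : a != 0) : << a0 >> = 1.
  have [y ay] := sq a; rewrite -(rank_one1 (oner_neq0 k)).
  apply: (rank_one_eq (y := y)); last by rewrite mul1r.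
  by apply: contra_neq a0 => y0; rewrite ay y0 expr0n.
have [a a0|m [n ->]] := GW_span w; first by left.
by exists (m + n)%:~R; rewrite rmorph_int (gen _ (N1_neq0 k)) -mulrzDr.
Qed.

(** * Sufficiency for a euclidean field *)

Section Euclidean.
Hypothesis euk : euclidean_field k.
Variable i : L.
Hypotheses (i2 : i ^+ 2 = -1) (iL : <<1; i>>%VS = {:L}%VS).

Lemma gal_i_inj (g g' : G) : g i = g' i -> g = g'.
Proof.
move=> gg'; apply/eqP/gal_eqP => a _.
have : a \in <<1; i>>%VS by rewrite iL memvf.
case/Fadjoin_polyP=> p /polyOver1P[q ->] ->.
have E (f : G) : f (map_poly (in_alg L) q).[i] = (map_poly (in_alg L) q).[f i].
  rewrite -horner_map -map_poly_comp; congr _.[_]; apply: eq_map_poly => c /=.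
  by rewrite linearZ /= rmorph1.
by rewrite !E gg'.
Qed.

Lemma gal_i : exists2 s : G, s i = - i & [set: G] = [set 1%g; s].
Proof.
have iN (g : G) : g i = i \/ g i = - i.
  have : (g i) ^+ 2 == i ^+ 2 by rewrite -rmorphXn /= i2 rmorphN rmorph1.
  by rewrite eqf_sqr => /orP[] /eqP; [left|right].
have [s si] : exists s : G, s i = - i.
  apply/not_existsP => noN; case: (euk) => real _.
  have [|c ic] := gal_invariant galL (y := i).
    by move=> g; case: (iN g) => // /noN.
  apply: real; exists [:: c]; rewrite big_seq1; apply: (fmorph_inj (in_alg L)).
  by rewrite rmorphXn /= -ic i2 scaleN1r.
exists s => //; apply/setP=> g; rewrite !inE; apply/esym/orP.
case: (iN g) => gi; [left|right]; apply/eqP/gal_i_inj; first by rewrite gal_id.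
by rewrite gi si.
Qed.

(** With $t = 1/r$ and $r^2 = 2$, the functions $g \mapsto g(t)$ and $g \mapsto g(it)$ on $G$ are
    orthogonal, of lengths $2t^2 = 1$ and $-2t^2 = -1$. *)
Lemma trace_form_i : h x = 1 + e.
Proof.
have [s si GE] := gal_i.
have two : 2%:R != 0 :> k by apply: formally_real_neq2; case: euk.
have twoL : 2%:R != 0 :> L by rewrite -(rmorph_nat (in_alg L)) fmorph_eq0.
have i0 : i != 0.
  by apply/eqP=> i0; move/eqP: i2; rewrite i0 expr0n eq_sym oppr_eq0 oner_eq0.
have s1 : 1%g != s.
  apply/eqP=> s1; case/negP: twoL; apply/eqP/(mulIf i0).
  by rewrite mul0r mulr_natl mulr2n -{1}[i]opprK -si -s1 gal_id addNr.
(* If $2 = -r^2$ instead, then $-1$ is twice the square of $r/2$. *)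
have [r r0 r2] : exists2 r : k, r != 0 & 2%:R = r ^+ 2.
  have [r r0 [E|E]] := euclidean_squares euk two; first by exists r.
  case: (euk) => real _; case: real; exists [:: r / 2%:R; r / 2%:R].
  rewrite !big_cons big_nil addr0 expr_div_n -[r ^+ 2]opprK -E.
  by field; rewrite (natrM _ 2 2) mulf_neq0.
have sumG (f : G -> L) : \sum_g f g = f 1%g + f s.
  rewrite (eq_bigl (mem [set: G])) => [|g]; last by rewrite /= inE.
  by rewrite GE big_setU1 ?inE //= big_set1.
pose t : L := r^-1%:A.
have st : s t = t by rewrite linearZ /= rmorph1.
have tt : t * t + t * t = 1.
  rewrite /t mulr_algl scalerA -scalerDl -mulr2n -mulr_natr r2.
  by rewrite [X in X *: _](_ : _ = 1) ?scale1r //; field.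
pose F (j : 'I_(1 + 1)) (g : G) : L :=
  g (match split j with inl _ => t | inr _ => i * t end).
rewrite (@hE _ _ (sbform_add (sbform_id k 1) (rank_one (N1_neq0 k)))).
  by rewrite GW_classD GW_class1.
split; first by rewrite -[RHS]cardsT GE cards2 s1.
exists F; split=> [j g a|j l]; first by rewrite /F /= galM ?memvf.
rewrite sumG /F /dsum_mx !gal_id mxE.
case: (splitP j) => j' _; rewrite mxE; case: (splitP l) => l' _.
- by rewrite !st tt !ord1 mxE scale1r.
- by rewrite rmorphM /= si !st mxE scale0r; ring.
- by rewrite rmorphM /= si !st mxE scale0r; ring.
rewrite rmorphM /= si !st !ord1 mxE.
transitivity (i ^+ 2 * (t * t + t * t)); last by ring.
by rewrite i2 tt mulr1 scaleN1r.
Qed.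

(** If $m + n[G]$ is in the kernel, rank gives $m = -2n$, so its image is $n(<-1> - 1)$ and $n = 0$
    because this difference is not torsion. For surjectivity, $<-1>$ is $h([G] - 1)$. *)
Lemma h_bij_euclidean : bijective h.
Proof.
have [real _] := euk.
have hx := trace_form_i.
have G2 : #|{: G}| = 2%N.
  by move: (congr1 rank hx); rewrite rank_h card_reg raddfD /= rank1 GW_rankE => -[].
apply: inj_surj_bij => [|w].
  apply: raddf_inj => z /=; have [|m [n ->]] := burnside_span _ z; first by rewrite G2.
  move=> hz; have := congr1 rank hz; rewrite rank_h raddf0 card_span G2 => mn.
  have en : e *~ n = n%:~R.
    have mE : m%:~R = - (n%:~R + n%:~R) :> GW k.
      by rewrite -mulrzDr -mulrNz; congr (_ *~ _); move: mn; lia.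
    move: hz; rewrite rmorphD rmorph_int raddfMz /= hx mE mulrzDl => hz.
    by apply/eqP; rewrite -subr_eq0 -hz opprD addrACA addNr add0r addrC.
  suff n0 : n = 0 by rewrite n0 (_ : m = 0) ?mulr0z ?addr0 //; move: mn; rewrite n0; lia.
  case: n {hz mn} en => n en; first by rewrite (GW_N1_torsion real en).
  by have := GW_N1_torsion real (oppr_inj en).
have gen (a : k) (a0 : a != 0) : << a0 >> = 1 \/ << a0 >> = e.
  have [y y0 ay] := euclidean_squares euk a0; rewrite -(rank_one1 (oner_neq0 k)).
  case: ay => ay; [left|right]; apply: (rank_one_eq _ _ y0); first by rewrite mul1r.
  by rewrite mulN1r.
have [m [n ->]] := GW_span w gen.
exists ((m - n)%:~R + x *~ n); rewrite rmorphD rmorph_int raddfMz /= hx.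
by rewrite mulrzBr mulrzDl addrA subrK.
Qed.

End Euclidean.
End TraceFormMorphism.

Theorem theorem3p4 (k : fieldType) (L : splittingFieldType k)
    (perfk : perfect_field k) (galL : galois 1 {:L}) :
  exists h : {rmorphism burnside (gal_of {:L}) -> GW k},
    [/\ sends_orbits_to_trace_forms galL h,
        (forall h' : {rmorphism burnside (gal_of {:L}) -> GW k},
           sends_orbits_to_trace_forms galL h' -> h' =1 h) &
        (bijective h <->
           (quadratically_closed k /\ {:L}%VS = 1%VS :> {vspace L})
           \/ (euclidean_field k /\
               exists2 i : L, i ^+ 2 = -1 & <<1; i>>%VS = {:L}%VS))].
Proof.
have [h hE] := trace_form_morphism galL.
have hO : sends_orbits_to_trace_forms galL h.
  by move=> H; apply/hE/descends_orbit.
exists h; split=> // [h' h'O|].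
  by apply: burnside_morphism_eq => H; rewrite /= h'O hO.
split=> [[g gK hK]|].
  have hI := can_inj gK; have hS w : exists z, h z = w by exists (g w).
  (* The preimage of the hyperbolic plane bounds the order of the group. *)
  have [y hy] := hS (1 + GW_class (rank_one (N1_neq0 k))).
  have := card_gal_dvd2 galL hE hI hy.
  rewrite dvdn_divisors // !inE => /orP[] /eqP Gn.
    left; split; first exact: (h_iso_trivial galL hE Gn hI hS).
    by apply/esym/eqP; rewrite eqEdim sub1v dimv1 -(card_gal galL) Gn.
  right; split; last exact: (quadratic_i galL hE Gn hI hS).
  apply: euclidean_criterion (square_dichotomy galL hE Gn hI hS) _.
  exact: (N1_neq_sum2 galL hE Gn hI).
case=> [[sq L1]|[euk [i i2 iL]]].
  by apply: (h_bij_trivial h sq); rewrite (card_gal galL) L1 dimv1.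
exact: (h_bij_euclidean galL hE euk i2 iL).
Qed.
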